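(* Let $\rho>0$ satisfy $$\widehat M_1\|\ell\|_{V'}+\theta_\rho\,\rho\le\rho,\qquad q_\rho<1 ,$$ and let $0<h\le h_0$. Given $u_1^0\in V$, let the continuous iterates $(u_1^{n+1},u_2^n)\in V\times V$, $n\ge0$, be defined by $$a_2(u_2^n,\eta)=\int_{B_R}\chi_2(u_1^n)^2\overline{\eta}\,dx\quad\forall\eta\in V,\qquad a_1(u_1^{n+1},\xi)=\int_{B_R}\chi_1\overline{u_1^n}u_2^n\overline{\xi}\,dx+\ell(\xi)\quad\forall\xi\in V,$$ and, given $u_{1,h}^0\in V_h$, let the discrete iterates $(u_{1,h}^{n+1},u_{2,h}^n)\in V_h\times V_h$, $n\ge0$, be defined by $$a_2(u_{2,h}^n,\eta_h)=\int_{B_R}\chi_2(u_{1,h}^n)^2\overline{\eta_h}\,dx\quad\forall\eta_h\in V_h,\qquad a_1(u_{1,h}^{n+1},\xi_h)=\int_{B_R}\chi_1\overline{u_{1,h}^n}u_{2,h}^n\overline{\xi_h}\,dx+\ell(\xi_h)\quad\forall\xi_h\in V_h.$$ Suppose that $\|u_1^0\|_V\le\rho$ and $\|u_{1,h}^0\|_V\le\rho$. Then for every $n\ge0$, $$\|u_1^n\|_V\le\rho,\quad\|u_{1,h}^n\|_V\le\rho,\quad\|u_2^n\|_V\le\sigma_\rho,\quad\|u_{2,h}^n\|_V\le\sigma_\rho .$$ Set $$\eta_{1,h}^{n+1}:=\inf_{z_h\in V_h}\|u_1^{n+1}-z_h\|_V,\qquad \eta_{2,h}^{n}:=\inf_{w_h\in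 V_h}\|u_2^{n}-w_h\|_V\qquad(n\ge0).$$ Then for every $n\ge0$, $$\|u_2^n-u_{2,h}^n\|_V\le C_{\rm qo}\eta_{2,h}^{n}+\beta_\rho\|u_1^n-u_{1,h}^n\|_V,$$ $$\|u_1^{n+1}-u_{1,h}^{n+1}\|_V\le C_{\rm qo}\eta_{1,h}^{n+1}+\theta_\rho\|u_1^n-u_{1,h}^n\|_V+\alpha_\rho\|u_2^n-u_{2,h}^n\|_V,$$ and $$\begin{aligned}\|u_1^n-u_{1,h}^n\|_V+\|u_2^n-u_{2,h}^n\|_V\le{}&(1+\beta_\rho)q_\rho^n\|u_1^0-u_{1,h}^0\|_V+C_{\rm qo}(1+\beta_\rho)\sum_{k=1}^{n}q_\rho^{n-k}\eta_{1,h}^{k}\\&+C_{\rm qo}(1+\beta_\rho)\alpha_\rho\sum_{m=0}^{n-1}q_\rho^{n-1-m}\eta_{2,h}^{m}+C_{\rm qo}\eta_{2,h}^{n},\end{aligned}$$ where a sum with an empty index set is understood to be zero.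
   Context: Setting. Let $d\in\{2,3\}$, let $D\subset\mathbb R^d$ be a bounded Lipschitz domain, and let $R>0$ be such that $\overline D\subset B_R$, where $B_R$ is the ball of radius $R$ centered at the origin, with boundary $\Gamma_R$ and outward unit normal $\nu$. Let $\kappa_1>0$ and $\kappa_2:=2\kappa_1$. For $j=1,2$ let $n_j\in L^\infty(B_R;\mathbb R)$ with $0<n_{\min}\le n_j\le n_{\max}<\infty$ a.e. and $n_j=1$ outside $\overline D$; let $\chi_j\in L^\infty(\mathbb R^d)$ be real-valued, nonnegative and supported in $\overline D$. Let $u^i(x)=\exp(i\kappa_1 d_0\cdot x)$ with $d_0\in\mathbb S^{d-1}$. Spaces. $V:=H^1(B_R;\mathbb C)$ with $\|\cdot\|_V:=\|\cdot\|_{H^1(B_R)}$; $V'$ is the anti-dual of $V$ (continuous conjugate-linear functionals, with the dual norm); $\gamma:V\to H^{1/2}(\Gamma_R)$ is the trace; $\langle\cdot,\cdot\rangle_{\Gamma_R}$ is the duality pairing of $H^{-1/2}(\Gamma_R)$ and $H^{1/2}(\Gamma_R)$, linear in the first and conjugate-linear in the second argument; $\langle F,v\rangle$ denotes the pairing of an anti-dual with its space, linear in $F$ and conjugate-linear in $v$. DtN map. For $k>0$ and $g\in H^{1/2}(\Gamma_R)$ let $w_g$ be the unique solution of $\Delta w_g+k^2w_g=0$ in $\mathbb R^d\setminus\overline{B_R}$, $w_g=g$ on $\Gamma_R$, satisfying the radiation condition $\lim_{r=|x|\to\infty}r^{(d-1)/2}(\partial_r w_g-ikw_g)=0$ uniformly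 in $x/|x|$. Set $T_kg:=\partial_\nu w_g|_{\Gamma_R}$; $T_k:H^{1/2}(\Gamma_R)\to H^{-1/2}(\Gamma_R)$ is bounded. Forms and data. For $j=1,2$, $a_j(w,\xi):=\int_{B_R}(\nabla w\cdot\nabla\overline\xi-\kappa_j^2n_jw\overline\xi)\,dx-\langle T_{\kappa_j}\gamma w,\gamma\xi\rangle_{\Gamma_R}$ on $V\times V$. The functional $\ell\in V'$ is $\ell(\xi):=\langle f_R,\gamma\xi\rangle_{\Gamma_R}$ with $f_R:=\partial_\nu u^i-T_{\kappa_1}(\gamma u^i)$. Continuous linear stability (known fact). For $j=1,2$ the operator $A_j:V\to V'$, $\langle A_jw,\phi\rangle:=a_j(w,\phi)$, is an isomorphism; $M_j>0$ is a constant with $\|A_j^{-1}g\|_V\le M_j\|g\|_{V'}$ for all $g\in V'$. Product constant. $C_{\rm prod}>0$ is a constant, depending only on $B_R$ and $d$, with $\|w\|_{L^4(B_R)}\|z\|_{L^4(B_R)}\|\phi\|_{L^2(B_R)}\le C_{\rm prod}\|w\|_V\|z\|_V\|\phi\|_V$ for all $w,z,\phi\in V$. Finite element spaces. $\{\mathcal T_h\}_{h>0}$ is a family of shape-regular conforming meshes of $B_R$ by triangles ($d=2$) or tetrahedra ($d=3$), curvilinear at $\Gamma_R$; $V_h\subset V$ is a (finite-dimensional) conforming space of piecewise polynomials of degree $p\ge1$ on $\mathcal T_h$, equipped with $\|\cdot\|_V$, with anti-dual $V_h'$ and its dual norm. The family is dense: $\inf_{z_h\in V_h}\|v-z_h\|_V\to0$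 as $h\to0$ for every $v\in V$. Discrete linear stability and quasi-optimality (known fact, fixing the constants). There are constants $h_0,M_{\rm lin},C_{\rm qo}>0$, independent of $h$, such that for $j=1,2$ and $0<h\le h_0$: (1) for every $g_h\in V_h'$ there is a unique $w_h\in V_h$ with $a_j(w_h,\phi_h)=\langle g_h,\phi_h\rangle$ for all $\phi_h\in V_h$, and $\|w_h\|_V\le M_{\rm lin}\|g_h\|_{V_h'}$; (2) if $g\in V'$, $w\in V$ solves $a_j(w,\phi)=\langle g,\phi\rangle$ for all $\phi\in V$, and $w_h\in V_h$ solves the problem in (1) with $g_h=g|_{V_h}$, then $\|w-w_h\|_V\le C_{\rm qo}\inf_{z_h\in V_h}\|w-z_h\|_V$. Derived constants. $\widehat M_j:=\max\{M_j,M_{\rm lin}\}$, and for $r>0$: $\alpha_r:=\widehat M_1C_{\rm prod}\|\chi_1\|_{L^\infty(B_R)}r$, $\beta_r:=2\widehat M_2C_{\rm prod}\|\chi_2\|_{L^\infty(B_R)}r$, $\sigma_r:=\beta_rr/2$, $\theta_r:=\widehat M_1C_{\rm prod}\|\chi_1\|_{L^\infty(B_R)}\sigma_r=\alpha_r\beta_r/2$, $q_r:=\theta_r+\alpha_r\beta_r=\tfrac32\alpha_r\beta_r$. *)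

(* Defs.v *)
From HB Require Import structures.
From mathcomp Require Import all_boot all_order all_algebra.
From mathcomp Require Import all_classical all_reals all_analysis.
From mathcomp Require Import measurable_realfun.
From mathcomp.real_closed Require Import complex.

Set Implicit Arguments.
Unset Strict Implicit.
Unset Printing Implicit Defensive.

Import Order.TTheory GRing.Theory Num.Theory.
Import numFieldNormedType.Exports.
Import ComplexField.Normc.
Local Open Scope classical_set_scope.
Local Open Scope complex_scope.
Local Open Scope ring_scope.

Section rowvec_measurable.
Variables (R : realType) (n : nat).

Let coord (i : 'I_n) (x : 'rV[R]_n) : measurableTypeR R := x 0 i.

Let rV_set0 : g_sigma_preimage coord set0.
Proof. exact: sigma_algebra0. Qed.

Let rV_setC A : g_sigma_preimage coord A -> g_sigma_preimage coord (~` A).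
Proof. exact: sigma_algebraC. Qed.

Let rV_bigcup (F : (set 'rV[R]_n)^nat) :
  (forall i, g_sigma_preimage coord (F i)) ->
  g_sigma_preimage coord (\bigcup_i F i).
Proof. exact: sigma_algebra_bigcup. Qed.

(* The Borel sigma-algebra, generated by the coordinates. *)
HB.instance Definition _ := @isMeasurable.Build default_measure_display
  'rV[R]_n (g_sigma_preimage coord) rV_set0 rV_setC rV_bigcup.

Lemma measurable_coord (i : 'I_n) :
  measurable_fun [set: 'rV[R]_n] (fun x => x 0 i).
Proof.
move=> _ Y mY; rewrite setTI; apply: sub_sigma_algebra => /=.
rewrite -bigcup_seq/=; exists i => /=; first by rewrite mem_index_enum.
by exists Y => //; rewrite setTI.
Qed.

Lemma measurable_fun_rowP d (T : measurableType d) (f : T -> 'rV[R]_n) :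
  (forall i, measurable_fun [set: T] (fun t => f t 0 i)) ->
  measurable_fun [set: T] f.
Proof.
move=> mf _ Y mY; rewrite setTI.
suff : g_sigma_preimage (fun i => coord i \o f) `<=` measurable.
  apply; rewrite g_sigma_preimage_comp; exists Y => //.
  by rewrite setTI.
apply: smallest_sub; first exact: sigma_algebra_measurable.
elim/big_ind: _ => [||i _]; first exact: sub0set.
  by move=> A B sA sB; rewrite subUset.
by move=> A [B mB <-]; exact: mf.
Qed.

End rowvec_measurable.

Section image_measure.
Context d1 d2 (T1 : measurableType d1) (T2 : measurableType d2) (R : realType).
Variables (m : {measure set T1 -> \bar R}) (f : {mfun T1 >-> T2}).

Definition image_measure := pushforward m f.

Let im0 : image_measure set0 = 0%E.
Proof. exact: measure0. Qed.

Let im_ge0 A : (0 <= image_measure A)%E.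
Proof. exact: measure_ge0. Qed.

Let im_sigma_additive : semi_sigma_additive image_measure.
Proof. exact: measure_semi_sigma_additive. Qed.

HB.instance Definition _ := isMeasure.Build _ _ _ image_measure
  im0 im_ge0 im_sigma_additive.

End image_measure.

Section lebesgue_measure_Rd.
Variable R : realType.

Definition row_rcons n (p : 'rV[R]_n * measurableTypeR R) : 'rV[R]_n.+1 :=
  \row_i oapp (fun j => p.1 0 j) p.2 (unlift ord_max i).

Lemma measurable_row_rcons n :
  measurable_fun [set: 'rV[R]_n * measurableTypeR R] (@row_rcons n).
Proof.
apply: measurable_fun_rowP => i; rewrite /row_rcons.
under eq_fun do rewrite mxE.
case: (unlift ord_max i) => [j|] /=; last exact: measurable_snd.
exact: (measurableT_comp (measurable_coord j)).
Qed.

HB.instance Definition _ n :=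
  isMeasurableFun.Build _ _ _ _ (@row_rcons n) (@measurable_row_rcons n).

(* Product of d copies of the one-dimensional Lebesgue measure. *)
Fixpoint leb (d : nat) : {measure set 'rV[R]_d -> \bar R} :=
  match d with
  | 0 => dirac (0 : 'rV[R]_0)
  | n.+1 => image_measure (leb n \x (@lebesgue_measure R))%E (@row_rcons n)
  end.

End lebesgue_measure_Rd.

Section euclidean.
Variables (R : realType) (d : nat).
Local Notation E := 'rV[R]_d.

Definition dot (x y : E) : R := \sum_i x 0 i * y 0 i.
Definition enorm (x : E) : R := Num.sqrt (dot x x).
Definition eball (r : R) : set E := [set x | enorm x < r].
Definition esphere (r : R) : set E := [set x | enorm x = r].

Lemma measurable_enorm : measurable_fun [set: E] enorm.
Proof.
apply: (measurableT_comp (continuous_measurable_fun (@sqrt_continuous R))).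
rewrite /dot; apply: measurable_sum => i.
by apply: measurable_funM; exact: measurable_coord.
Qed.

Lemma measurable_eball (r : R) : measurable (eball r).
Proof.
rewrite -[eball r]setTI (_ : eball r = enorm @^-1` `]-oo, r[).
  exact: measurable_enorm.
by apply/seteqP; split => x /=; rewrite in_itv.
Qed.

Definition radial_proj (r : R) (x : E) : E := (r / enorm x) *: x.

Lemma measurable_radial_proj (r : R) :
  measurable_fun [set: E] (radial_proj r).
Proof.
apply: measurable_fun_rowP => i; rewrite /radial_proj.
under eq_fun do rewrite mxE.
apply: measurable_funM; last exact: measurable_coord.
apply: measurable_funM => //.
under eq_fun do rewrite -powR_inv1 ?sqrtr_ge0//.
exact: (measurableT_comp (measurable_powR _) measurable_enorm).
Qed.

HB.instance Definition _ r :=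
  isMeasurableFun.Build _ _ _ _ (radial_proj r) (@measurable_radial_proj r).

(* The surface measure of the sphere of radius r, as a measure on R^d: by
   integration in polar coordinates a subset of the sphere has d / r times the
   volume of the cone over it. *)
Definition sphere_measure (r : R) : {measure set E -> \bar R} :=
  mscale (`|d%:R / r|%:nng)
    (image_measure (mrestr (leb R d) (measurable_eball r)) (radial_proj r)).

End euclidean.

Section differentiation.
Variables (R : realType) (d : nat).
Local Notation E := 'rV[R]_d.
Local Notation C := R[i].
Implicit Types (U : set E) (f : E -> R) (w phi : E -> C).

Definition partial (i : 'I_d) f : E -> R := fun x => 'D_(delta_mx 0 i) f x.

Fixpoint Ck_on (k : nat) U f : Prop :=
  match k with
  | 0 => forall x, U x -> {for x, continuous f}
  | k.+1 => forall i, (forall x, U x -> derivable f x (delta_mx 0 i)) /\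
                      Ck_on k U (partial i f)
  end.

Definition smooth f := forall k, Ck_on k setT f.

Definition tsupport (V : zmodType) (f : E -> V) : set E :=
  closure [set x | f x != 0].

Definition test_function U f :=
  [/\ smooth f, compact (tsupport f) & tsupport f `<=` U].

Definition re_part w : E -> R := fun x => complex.Re (w x).
Definition im_part w : E -> R := fun x => complex.Im (w x).

Definition cCk_on (k : nat) U w :=
  Ck_on k U (re_part w) /\ Ck_on k U (im_part w).

Definition ctest_function w :=
  [/\ smooth (re_part w), smooth (im_part w) & compact (tsupport w)].

Definition cpartial (i : 'I_d) w : E -> C :=
  fun x => partial i (re_part w) x +i* partial i (im_part w) x.

Definition cgrad w : E -> 'rV[C]_d := fun x => \row_i cpartial i w x.

(* The derivative in the direction x / |x|; on a centered sphere this is the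
   derivative along the outward unit normal. *)
Definition radial_derivative w : E -> C :=
  fun x => \sum_i (x 0 i / enorm x)%:C * cpartial i w x.

Definition laplacian w : E -> C :=
  fun x => \sum_i cpartial i (cpartial i w) x.

End differentiation.

Section complex_integration.
Variables (R : realType) (disp : measure_display) (T : measurableType disp).
Local Notation C := R[i].

Definition cint (mu : {measure set T -> \bar R}) (A : set T) (f : T -> C) : C :=
  (\int[mu]_(x in A) complex.Re (f x)) +i* (\int[mu]_(x in A) complex.Im (f x)).

Definition cmeasurable (A : set T) (f : T -> C) :=
  measurable_fun A (fun x => complex.Re (f x)) /\
  measurable_fun A (fun x => complex.Im (f x)).

(* The norm of L^p(A), through extension by zero outside A. *)
Definition Lp_norm (mu : {measure set T -> \bar R}) (p : \bar R) (A : set T)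
    (f : T -> R) : \bar R :=
  'N[mu]_p[(EFin \o f) \_ A]%E.

End complex_integration.

(* A subset of a complex vector space with a seminorm.  Functions are not
   identified when they agree almost everywhere: two elements x, y of the
   carrier stand for the same element of the normed space exactly when
   nrm (x - y) = 0. *)
Record seminormed (R : realType) (U : lmodType R[i]) := Seminormed {
  carrier : set U;
  nrm : U -> R }.

Section functional_analysis.
Variable R : realType.
Local Notation C := R[i].
Variables (U W : lmodType C).
Implicit Types (X : seminormed U) (Y : seminormed W).

Definition bounded_linear X Y (A : U -> W) :=
  [/\ forall x, carrier X x -> carrier Y (A x),
      forall (a : C) x y, carrier X x -> carrier X y ->
        nrm Y (A (a *: x + y) - (a *: A x + A y)) = 0 &
      exists c, forall x, carrier X x -> nrm Y (A x) <= c * nrm X x].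

Definition isomorphism X Y (A : U -> W) :=
  [/\ bounded_linear X Y A,
      exists c, forall x, carrier X x -> nrm X x <= c * nrm Y (A x) &
      forall y, carrier Y y -> exists2 x, carrier X x & nrm Y (A x - y) = 0].

(* Continuous conjugate-linear functionals with the dual norm. *)
Definition antidual X : seminormed (U -> C) := Seminormed
  [set F | (forall (a : C) x y, carrier X x -> carrier X y ->
             F (a *: x + y) = a^* * F x + F y) /\
           exists c, forall x, carrier X x -> normc (F x) <= c * nrm X x]
  (fun F => sup [set normc (F x) | x in
                  [set x | carrier X x /\ nrm X x <= 1]]).

Definition linear_subspace X (A : set U) :=
  [/\ A `<=` carrier X, A 0 &
      forall (a : C) x y, A x -> A y -> A (a *: x + y)].

Definition sub_space X (A : set U) : seminormed U := Seminormed A (nrm X).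

Definition finite_dimensional X :=
  exists (m : nat) (b : 'I_m -> U), (forall i, carrier X (b i)) /\
    forall x, carrier X x -> exists c : 'I_m -> C,
      nrm X (x - \sum_i c i *: b i) = 0.

Definition dist X (A : set U) (x : U) : R := inf [set nrm X (x - z) | z in A].

End functional_analysis.

Section sobolev.
Variables (R : realType) (d : nat).
Local Notation E := 'rV[R]_d.
Local Notation C := R[i].

Definition cdot (x y : 'rV[C]_d) : C := \sum_i x 0 i * (y 0 i)^*.

(* A function together with its weak gradient, which is part of the data
   because it is only unique up to a null set. *)
Definition sob : Type := (E -> C) * (E -> 'rV[C]_d).
HB.instance Definition _ := GRing.Lmodule.on sob.

Definition with_grad (w : E -> C) : sob := (w, cgrad w).

Definition sob_density (v : sob) (x : E) : R :=
  normc (v.1 x) ^+ 2 + \sum_i normc (v.2 x 0 i) ^+ 2.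

Definition weak_gradient (Om : set E) (v : sob) :=
  forall phi : E -> R, test_function Om phi -> forall i,
    cint (leb R d) Om (fun x => v.1 x * (partial i phi x)%:C) =
    - cint (leb R d) Om (fun x => v.2 x 0 i * (phi x)%:C).

Definition H1 (Om : set E) : seminormed sob := Seminormed
  [set v : sob |
    [/\ cmeasurable Om v.1,
        forall i, cmeasurable Om (fun x => v.2 x 0 i),
        (\int[leb R d]_(x in Om) (sob_density v x)%:E < +oo)%E &
        weak_gradient Om v]]
  (fun v => Num.sqrt (\int[leb R d]_(x in Om) sob_density v x)).

(* H^{1/2} of the sphere of radius r, with the Sobolev-Slobodeckij norm. *)
Definition gagliardo (r : R) (g : E -> C) : \bar R :=
  (\int[sphere_measure d r]_x \int[sphere_measure d r]_y
     (normc (g x - g y) ^+ 2 / enorm (x - y) ^+ d)%:E)%E.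

Definition sphere_L2sq (r : R) (g : E -> C) : \bar R :=
  (\int[sphere_measure d r]_x (normc (g x) ^+ 2)%:E)%E.

Definition H12 (r : R) : seminormed (E -> C) := Seminormed
  [set g | [/\ cmeasurable setT g, (sphere_L2sq r g < +oo)%E &
               (gagliardo r g < +oo)%E]]
  (fun g => Num.sqrt (fine (sphere_L2sq r g + gagliardo r g)%E)).

(* g is the trace of v in H^1(Om) on the sphere of radius r (a part of the
   boundary of Om): the common limit of test functions, in H^1(Om) to v and,
   restricted to the sphere, in L^2 to g. *)
Definition trace_on (Om : set E) (r : R) (v : sob) (g : E -> C) :=
  [/\ carrier (H1 Om) v, cmeasurable setT g &
      exists phi : nat -> E -> C,
        [/\ forall m, ctest_function (phi m),
            nrm (H1 Om) (v - with_grad (phi m)) @[m --> \oo] --> (0 : R) &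
            sphere_L2sq r (g \- phi m) @[m --> \oo] --> 0%E]].

Definition trace_operator (r : R) (gamma : sob -> E -> C) :=
  bounded_linear (H1 (eball r)) (H12 r) gamma /\
  forall v, carrier (H1 (eball r)) v -> trace_on (eball r) r v (gamma v).

End sobolev.

Section scattering.
Variables (R : realType) (d : nat).
Local Notation E := 'rV[R]_d.
Local Notation C := R[i].
Implicit Types (r k : R) (w g : E -> C).

Definition exterior r : set E := [set x | r < enorm x].

Definition annulus r1 r2 : set E := exterior r1 `&` eball r2.

Definition radiation_condition k w :=
  forall e : R, 0 < e -> exists rho : R, forall x : E, rho <= enorm x ->
    (enorm x) `^ ((d%:R - 1) / 2) *
      normc (radial_derivative w x - (0 +i* k) * w x) <= e.

Definition exterior_solution r k g w :=
  [/\ cCk_on 2 (exterior r) w,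
      forall x, exterior r x -> laplacian w x + (k ^+ 2)%:C * w x = 0,
      forall r', r < r' -> carrier (H1 (annulus r r')) (with_grad w),
      trace_on (annulus r (2 * r)) r (with_grad w) g &
      radiation_condition k w].

(* t is the normal derivative of w on the sphere of radius r, defined by
   Green's formula in the exterior; the sign is that of the normal which
   points away from the origin. *)
Definition exterior_normal_derivative r k w (t : (E -> C) -> C) :=
  forall phi : E -> C, ctest_function phi ->
    t phi = - cint (leb R d) (exterior r) (fun x =>
      cdot (cgrad w x) (cgrad phi x) - (k ^+ 2)%:C * w x * (phi x)^*).

Definition dtn_map r k (T : (E -> C) -> (E -> C) -> C) :=
  bounded_linear (H12 d r) (antidual (H12 d r)) T /\
  forall g, carrier (H12 d r) g -> exists w,
    [/\ exterior_solution r k g w,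
        forall w', exterior_solution r k g w' ->
          forall x, exterior r x -> w' x = w x &
        exterior_normal_derivative r k w (T g)].

Definition plane_wave k (d0 : E) : E -> C :=
  fun x => cos (k * dot d0 x) +i* sin (k * dot d0 x).

Definition helmholtz_form r k (n : E -> R) (T : (E -> C) -> (E -> C) -> C)
    (gamma : sob R d -> E -> C) (w xi : sob R d) : C :=
  cint (leb R d) (eball r) (fun x =>
    cdot (w.2 x) (xi.2 x) - (k ^+ 2 * n x)%:C * w.1 x * (xi.1 x)^*)
  - T (gamma w) (gamma xi).

(* f_R = d_nu u^i - T (gamma u^i), the first term acting by integration. *)
Definition incident_flux r k (d0 : E) (T : (E -> C) -> (E -> C) -> C)
    (gamma : sob R d -> E -> C) (g : E -> C) : C :=
  cint (sphere_measure d r) setT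
    (fun x => radial_derivative (plane_wave k d0) x * (g x)^*)
  - T (gamma (with_grad (plane_wave k d0))) g.

Definition refractive_index r (D : set E) (nmin nmax : R) (n : E -> R) :=
  [/\ measurable_fun (eball r) n,
      {ae leb R d, forall x, eball r x -> nmin <= n x <= nmax} &
      {ae leb R d, forall x, eball r x -> ~ closure D x -> n x = 1}].

Definition susceptibility (D : set E) (chi : E -> R) :=
  [/\ measurable_fun setT chi, (Lp_norm (leb R d) +oo setT chi < +oo)%E,
      {ae leb R d, forall x, 0 <= chi x} &
      {ae leb R d, forall x, ~ closure D x -> chi x = 0}].

Definition product_constant r (c : R) :=
  forall w z phi : sob R d, let V := H1 (eball r) in
    carrier V w -> carrier V z -> carrier V phi ->
    (Lp_norm (leb R d) 4%:E (eball r) (fun x => normc (w.1 x)) *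
     Lp_norm (leb R d) 4%:E (eball r) (fun x => normc (z.1 x)) *
     Lp_norm (leb R d) 2%:E (eball r) (fun x => normc (phi.1 x))
     <= (c * nrm V w * nrm V z * nrm V phi)%:E)%E.

End scattering.

Section domains_and_meshes.
Variables (R : realType) (d : nat).
Local Notation E := 'rV[R]_d.
Local Notation C := R[i].

(* Near each boundary point D lies strictly on one side of a Lipschitz graph
   over the hyperplane orthogonal to some unit vector e. *)
Definition lipschitz_boundary (D : set E) :=
  forall x, (closure D `\` D) x -> exists (rho L : R) (e : E) (zeta : E -> R),
    [/\ 0 < rho, enorm e = 1,
        forall y z, `|zeta y - zeta z| <= L * enorm (y - z) &
        forall y, enorm (y - x) < rho ->
          (D y <-> zeta (y - dot e y *: e) < dot e y)].

Definition bounded_lipschitz_domain (D : set E) :=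
  [/\ D !=set0, open D, connected D, bounded_set D & lipschitz_boundary D].

Definition ref_simplex : set E :=
  [set x | (forall i, 0 <= x 0 i) /\ \sum_i x 0 i <= 1].

Definition barycentric (x : E) (i : 'I_d.+1) : R :=
  oapp (fun j => x 0 j) (1 - \sum_j x 0 j) (unlift ord0 i).

(* The face spanned by the vertices in S; it is empty when S is. *)
Definition ref_face (S : {set 'I_d.+1}) : set E :=
  [set x | ref_simplex x /\ forall i, i \notin S -> barycentric x i = 0].

Record mesh := Mesh {
  ncells : nat;
  cell_map : 'I_ncells -> E -> E }.

Definition cell (T : mesh) (K : 'I_(ncells T)) : set E :=
  cell_map K @` ref_simplex.

Definition diam (A : set E) : R :=
  sup [set enorm (p.1 - p.2) | p in A `*` A].

Definition affine_on (A : set E) (F : E -> E) :=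
  exists (M : 'M[R]_d) (b : E), forall x, A x -> F x = x *m M + b.

(* Conforming meshes of the closed ball of radius r by images of the reference
   simplex, where only cells that reach the sphere may be curved. *)
Definition conforming_mesh (r : R) (T : mesh) :=
  [/\ forall K : 'I_(ncells T),
        exists2 O : set E, open O /\ ref_simplex `<=` O &
          forall i, Ck_on 1 O (fun x => cell_map K x 0 i),
      forall (K : 'I_(ncells T)) x y, ref_simplex x -> ref_simplex y ->
        cell_map K x = cell_map K y -> x = y,
      forall K : 'I_(ncells T), cell K `&` esphere r = set0 ->
        affine_on ref_simplex (cell_map K),
      \bigcup_(K in [set: 'I_(ncells T)]) cell K = [set x | enorm x <= r] &
      forall K K' : 'I_(ncells T), K != K' ->
        exists S S' : {set 'I_d.+1}, [/\ S != [set: 'I_d.+1]%SET,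
          S' != [set: 'I_d.+1]%SET,
          cell K `&` cell K' = cell_map K @` ref_face S &
          cell K `&` cell K' = cell_map K' @` ref_face S']].

(* Each cell map has a derivative of size at most s * diam K, with inverse of
   size at most s / diam K; for affine cells this is a bound on the ratio of
   the diameter to the inradius. *)
Definition shape_regular (s : R) (T : mesh) :=
  forall (K : 'I_(ncells T)) x v, ref_simplex x ->
    s^-1 * diam (cell K) * enorm v <= enorm ('D_v (cell_map K) x) /\
    enorm ('D_v (cell_map K) x) <= s * diam (cell K) * enorm v.

Definition polynomial_fun (p : nat) (f : E -> C) :=
  exists c : {ffun 'I_d -> 'I_p.+1} -> C, forall x, f x =
    \sum_(a : {ffun 'I_d -> 'I_p.+1} | (\sum_i a i <= p)%N)
      c a * (\prod_i x 0 i ^+ a i)%:C.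

(* As usual for curved cells, the polynomials live on the reference simplex. *)
Definition piecewise_polynomial (p : nat) (T : mesh) (v : E -> C) :=
  forall K : 'I_(ncells T), exists2 q, polynomial_fun p q &
    {ae leb R d, forall x, ref_simplex x -> v (cell_map K x) = q x}.

Definition fe_space (r : R) (p : nat) (T : mesh) (Vh : set (sob R d)) :=
  let V := H1 (eball r) in
  [/\ linear_subspace V Vh, finite_dimensional (sub_space V Vh) &
      forall v, Vh v -> piecewise_polynomial p T v.1].

End domains_and_meshes.

Section stability.
Variables (R : realType) (U : lmodType R[i]).
Implicit Types (V : seminormed U) (a : U -> U -> R[i]).

(* M bounds the inverse of the isomorphism w |-> a w from V to its
   anti-dual. *)
Definition continuous_stability V a (M : R) :=
  isomorphism V (antidual V) a /\
  forall g w, carrier (antidual V) g -> carrier V w ->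
    (forall phi, carrier V phi -> a w phi = g phi) ->
    nrm V w <= M * nrm (antidual V) g.

Definition discrete_stability V a (Vh : set U) (M : R) :=
  let X := sub_space V Vh in
  forall g, carrier (antidual X) g -> exists2 w,
    Vh w /\ (forall phi, Vh phi -> a w phi = g phi) &
    nrm V w <= M * nrm (antidual X) g /\
    forall w', Vh w' -> (forall phi, Vh phi -> a w' phi = g phi) ->
      nrm V (w' - w) = 0.

Definition quasi_optimality V a (Vh : set U) (c : R) :=
  forall g w wh, carrier (antidual V) g -> carrier V w -> Vh wh ->
    (forall phi, carrier V phi -> a w phi = g phi) ->
    (forall phi, Vh phi -> a wh phi = g phi) ->
    nrm V (w - wh) <= c * dist V Vh w.

End stability.

(* Main.v *)
Require Import Defs.
From mathcomp Require Import all_boot all_order all_algebra.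
From mathcomp Require Import all_classical all_reals all_analysis.
From mathcomp Require Import measurable_realfun ring lra.
From mathcomp.real_closed Require Import complex.
Import Order.TTheory GRing.Theory Num.Theory.
Import numFieldNormedType.Exports.
Import ComplexField.Normc.
Local Open Scope classical_set_scope.
Local Open Scope complex_scope.
Local Open Scope ring_scope.

Set Implicit Arguments.
Unset Strict Implicit.
Unset Printing Implicit Defensive.

(** Each half-step of either iteration solves a linear problem with form a_1 or
    a_2 whose right-hand side is a quadratic expression in the previous iterates,
    plus, for a_1, the incident field.  Everything follows from two facts: these
    right-hand sides are bounded and locally Lipschitz as elements of the
    anti-dual, and the linear problems are stable.

    The right-hand sides are functionals phi |-> int chi p conj(phi), where p is
    a product of two elements of V, one of them possibly conjugated.  Hoelder's
    inequality with exponents 4, 4, 2 and the product constant bound such a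
    functional by |chi|_oo C_prod |w| |z| ([source_le]).  Writing
      u^2 - v^2 = (u - v)(u + v)   and
      conj(u) v - conj(u') v' = conj(u - u') v + conj(u') (v - v')
    gives the Lipschitz bounds on the balls of radius rho and sigma.

    Stability turns the first bounds into the invariance of these balls, by
    induction on n ([continuous_solution_le], [discrete_solution_le]).  For the
    errors, the Galerkin solution with the exact right-hand side is inserted
    between the exact and the discrete iterate: quasi-optimality controls its
    distance to the former, and discrete stability with the Lipschitz bounds
    its distance to the latter ([galerkin_error_le]).  The resulting two coupled
    inequalities are solved in [coupled_error_recursion].

    The elements of V are functions paired with weak gradients, so one must
    check that V is a seminormed vector space ([H1_seminorm_laws]); in
    particular the difference of two iterates has to lie in V before the product
    constant can be applied to it.  The delicate point there is that the
    integrals defining the weak gradient are finite, which rests on the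
    measurability of continuous functions for the sigma-algebra generated by
    the coordinates and on the finite volume of the ball.  Linearity of the forms
    a_j, on the other hand, needs no computation: it is part of their being
    isomorphisms onto the anti-dual ([isomorphismB]). *)

(** * Moduli of complex numbers *)

Section complex_numbers.
Variable R : rcfType.
Implicit Types z w : R[i].

Lemma normcE z : normc z = Num.sqrt (complex.Re z ^+ 2 + complex.Im z ^+ 2).
Proof. by case: z. Qed.

Lemma normc_ge0 z : 0 <= normc z.
Proof. by rewrite normcE sqrtr_ge0. Qed.

Lemma sqr_normcE z : normc z ^+ 2 = complex.Re z ^+ 2 + complex.Im z ^+ 2.
Proof. by rewrite normcE sqr_sqrtr// addr_ge0 ?sqr_ge0. Qed.

Lemma normc_real (r : R) : normc r%:C = `|r|.
Proof. by rewrite normcE/= expr0n addr0 sqrtr_sqr. Qed.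

Lemma normc_conj z : normc z^* = normc z.
Proof. by rewrite !normcE; case: z => a b /=; rewrite sqrrN. Qed.

Lemma Re_le_normc z : `|complex.Re z| <= normc z.
Proof. by rewrite normcE -sqrtr_sqr ler_wsqrtr// lerDl sqr_ge0. Qed.

Lemma Im_le_normc z : `|complex.Im z| <= normc z.
Proof. by rewrite normcE -sqrtr_sqr ler_wsqrtr// lerDr sqr_ge0. Qed.

Lemma ReM z w :
  complex.Re (z * w) = complex.Re z * complex.Re w - complex.Im z * complex.Im w.
Proof. by case: z; case: w. Qed.

Lemma ImM z w :
  complex.Im (z * w) = complex.Re z * complex.Im w + complex.Im z * complex.Re w.
Proof. by case: z => a b; case: w => c d /=. Qed.

Lemma ReD z w : complex.Re (z + w) = complex.Re z + complex.Re w.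
Proof. by case: z; case: w. Qed.

Lemma ImD z w : complex.Im (z + w) = complex.Im z + complex.Im w.
Proof. by case: z; case: w. Qed.

End complex_numbers.

(** * Seminormed spaces and anti-duals *)

Section antidual_theory.
Variables (R : realType) (U : lmodType R[i]).
Implicit Types (X : seminormed U) (F G : U -> R[i]) (A : set U).

(** A [seminormed] record is bare data; these are the properties that make it a
    seminormed vector space. *)
Definition seminorm_laws X :=
  [/\ carrier X 0,
      forall (a : R[i]) x y, carrier X x -> carrier X y -> carrier X (a *: x + y),
      forall (a : R[i]) x, carrier X x -> nrm X (a *: x) = normc a * nrm X x &
      forall x y, carrier X x -> carrier X y ->
        nrm X (x + y) <= nrm X x + nrm X y].

Lemma seminorm_laws_sub X A :
  seminorm_laws X -> linear_subspace X A -> seminorm_laws (sub_space X A).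
Proof.
move=> [_ _ XZ XD] [AX A0 AL]; split => //=.
- by move=> a x Ax; apply: XZ; exact: AX.
- by move=> x y Ax Ay; apply: XD; exact: AX.
Qed.

Section fixed_space.
Variable X : seminormed U.
Hypothesis HX : seminorm_laws X.

Lemma carrierZ a x : carrier X x -> carrier X (a *: x).
Proof. by case: HX => X0 XL _ _ Xx; rewrite -[_ *: _]addr0; exact: XL. Qed.

Lemma carrierD x y : carrier X x -> carrier X y -> carrier X (x + y).
Proof.
by case: HX => X0 XL _ _ Xx Xy; rewrite -[x]scale1r; exact: XL.
Qed.

Lemma carrierB x y : carrier X x -> carrier X y -> carrier X (x - y).
Proof.
by move=> Xx Xy; rewrite -scaleN1r; apply: carrierD => //; exact: carrierZ.
Qed.

Lemma nrm0 : nrm X 0 = 0.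
Proof.
by case: HX => X0 _ XZ _; rewrite -[X in nrm _ X](scale0r 0) XZ// normc0 mul0r.
Qed.

Lemma nrmN x : carrier X x -> nrm X (- x) = nrm X x.
Proof.
by case: HX => _ _ XZ _ Xx; rewrite -scaleN1r XZ// normcN normc1 mul1r.
Qed.

Lemma nrmD x y : carrier X x -> carrier X y -> nrm X (x + y) <= nrm X x + nrm X y.
Proof. by case: HX => _ _ _; exact. Qed.

Lemma nrm_ge0 x : carrier X x -> 0 <= nrm X x.
Proof.
move=> Xx; have XNx : carrier X (- x) by rewrite -scaleN1r; exact: carrierZ.
have := nrmD Xx XNx; rewrite subrr nrm0 nrmN// -mulr2n.
by rewrite pmulrn_lge0.
Qed.

Lemma antidual_unit_le F x : carrier (antidual X) F -> carrier X x ->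
  nrm X x <= 1 -> normc (F x) <= nrm (antidual X) F.
Proof.
move=> [_ [c Fc]] Xx x1; apply: ub_le_sup; last by exists x.
exists `|c| => _ [y [Xy y1] <-]; apply: le_trans (Fc _ Xy) _.
apply: le_trans (ler_norm _) _; rewrite normrM -[leRHS]mulr1 ler_wpM2l//.
by rewrite ger0_norm ?nrm_ge0.
Qed.

Lemma antidual_nrm_ge0 F : carrier (antidual X) F -> 0 <= nrm (antidual X) F.
Proof.
move=> FX; have [X0 _ _ _] := HX; apply: le_trans (antidual_unit_le FX X0 _).
  by rewrite normc_ge0.
by rewrite nrm0 ler01.
Qed.

(** Rescaling to the unit ball turns the supremum into an operator bound; a
    vector of seminorm zero cannot be rescaled, and there the continuity of the
    functional is used instead. *)
Lemma antidual_le F x : carrier (antidual X) F -> carrier X x ->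
  normc (F x) <= nrm (antidual X) F * nrm X x.
Proof.
move=> FX Xx; have [Flin [c Fc]] := FX; have [X0 _ XZ _] := HX.
have F0 : F 0 = 0.
  have /eqP := Flin 1 _ _ X0 X0.
  by rewrite scaler0 addr0 rmorph1 mul1r -subr_eq subrr eq_sym => /eqP.
have FZ a y : carrier X y -> F (a *: y) = a^* * F y.
  by move=> Xy; rewrite -[_ *: _]addr0 Flin// F0 addr0.
have [x0|xn0] := eqVneq (nrm X x) 0.
  by rewrite x0 mulr0; have := Fc _ Xx; rewrite x0 mulr0.
have xgt0 : 0 < nrm X x by rewrite lt_neqAle eq_sym xn0 nrm_ge0.
have ninv : 0 <= (nrm X x)^-1 by rewrite invr_ge0 ltW.
rewrite -ler_pdivrMr// -[leLHS]mulrC.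
have -> : (nrm X x)^-1 * normc (F x) = normc (F ((nrm X x)^-1%:C *: x)).
  have cR (s : R) : (s%:C)^* = s%:C by exact: conjc_real.
  by rewrite FZ// cR normcM normc_real ger0_norm.
apply: antidual_unit_le => //; first exact: carrierZ.
by rewrite XZ// normc_real ger0_norm// mulVf.
Qed.

Lemma antidual_nrm_le F (c : R) : 0 <= c ->
  (forall x, carrier X x -> normc (F x) <= c * nrm X x) ->
  nrm (antidual X) F <= c.
Proof.
move=> c0 Fc; apply: ge_sup.
  exists (normc (F 0)), 0 => //; split; [by case: HX|by rewrite nrm0 ler01].
move=> _ [x [Xx x1] <-]; apply: le_trans (Fc _ Xx) _.
by rewrite -[leRHS]mulr1 ler_wpM2l.
Qed.

Lemma antidualD F G : carrier (antidual X) F -> carrier (antidual X) G ->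
  carrier (antidual X) (fun x => F x + G x).
Proof.
move=> [Fl [c Fc]] [Gl [c' Gc]]; split=> [a x y Xx Xy|].
  by rewrite Fl// Gl//; ring.
exists (c + c') => x Xx; rewrite mulrDl.
by apply: le_trans (le_normcD _ _) _; rewrite lerD// ?Fc ?Gc.
Qed.

Lemma antidualZ (b : R[i]) F : carrier (antidual X) F ->
  carrier (antidual X) (fun x => b * F x).
Proof.
move=> [Fl [c Fc]]; split=> [a x y Xx Xy|]; first by rewrite Fl//; ring.
exists (normc b * c) => x Xx; rewrite normcM -mulrA ler_wpM2l ?Fc//.
exact: normc_ge0.
Qed.

Lemma antidualB F G : carrier (antidual X) F -> carrier (antidual X) G ->
  carrier (antidual X) (fun x => F x - G x).
Proof.
move=> FX /(antidualZ (-1)) /(antidualD FX).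
by congr (carrier _ _); apply/funext => x; rewrite mulN1r.
Qed.

Lemma antidual_restrict A F : linear_subspace X A -> carrier (antidual X) F ->
  carrier (antidual (sub_space X A)) F.
Proof.
move=> [AX _ _] [Fl [c Fc]]; split=> [a x y /AX ? /AX ?|]; first exact: Fl.
by exists c => x /AX; exact: Fc.
Qed.

(** The linearity in the definition of an isomorphism holds up to elements of
    seminorm zero; in an anti-dual these vanish identically on the space. *)
Lemma isomorphismB (a : U -> U -> R[i]) w z phi :
  isomorphism X (antidual X) a -> carrier X w -> carrier X z ->
  carrier X phi -> a (w - z) phi = a w phi - a z phi.
Proof.
move=> [[aX aL _] _ _] Xw Xz Xphi.
have XB := carrierB Xw Xz.
have XBN : carrier X (-1 *: z + w) by rewrite scaleN1r addrC.
pose F : U -> R[i] := a (-1 *: z + w) - (-1 *: a z + a w).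
have FX : carrier (antidual X) F.
  have := antidualB (aX _ XBN) (antidualB (aX _ Xw) (aX _ Xz)).
  by congr (carrier _ _); apply/funext => x; rewrite /F !scaleN1r [- a z + _]addrC.
have := antidual_le FX Xphi; rewrite /F aL// mul0r => F0.
have /eq0_normc : normc (F phi) = 0.
  by apply/eqP; rewrite eq_le F0 normc_ge0.
have -> : F phi = a (w - z) phi - (a w phi - a z phi).
  by rewrite /F !scaleN1r [- a z + _]addrC [- z + _]addrC.
by move/eqP; rewrite subr_eq0 => /eqP.
Qed.

End fixed_space.
End antidual_theory.

(** * Stability and error of one Galerkin step *)

Section galerkin_step.
Variables (R : realType) (U : lmodType R[i]) (V : seminormed U).
Variables (a : U -> U -> R[i]) (M Mlin Cqo : R) (Vh : set U).
Hypothesis HV : seminorm_laws V.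
Hypothesis stab : continuous_stability V a M.
Hypothesis subVh : linear_subspace V Vh.
Hypothesis dstab : discrete_stability V a Vh Mlin.
Hypothesis qopt : quasi_optimality V a Vh Cqo.
Hypotheses (M_ge0 : 0 <= M) (Mlin_ge0 : 0 <= Mlin).

Let HVh := seminorm_laws_sub HV subVh.
Let VhV x : Vh x -> carrier V x. Proof. by case: subVh => + _ _; exact. Qed.

Lemma continuous_solution_le g w c : carrier (antidual V) g -> 0 <= c ->
  (forall phi, carrier V phi -> normc (g phi) <= c * nrm V phi) ->
  carrier V w -> (forall phi, carrier V phi -> a w phi = g phi) ->
  nrm V w <= M * c.
Proof.
move=> gV c0 gc Vw aw; case: stab => _ /(_ _ _ gV Vw aw) /le_trans; apply.
by rewrite ler_wpM2l//; exact: antidual_nrm_le.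
Qed.

(** The stability hypothesis bounds some solution only; any other one is at
    seminorm distance zero from it. *)
Lemma discrete_solution_le g w c :
  carrier (antidual (sub_space V Vh)) g -> 0 <= c ->
  (forall phi, Vh phi -> normc (g phi) <= c * nrm V phi) ->
  Vh w -> (forall phi, Vh phi -> a w phi = g phi) ->
  nrm V w <= Mlin * c.
Proof.
move=> gV c0 gc Vw aw; have [w0 [Vw0 _] [w0g uniq]] := dstab gV.
rewrite -[w](subrK w0); apply: le_trans (nrmD HV _ (VhV Vw0)) _.
  by apply: (carrierB HV); exact: VhV.
rewrite (uniq _ Vw aw) add0r; apply: le_trans w0g _.
by rewrite ler_wpM2l//; exact: (antidual_nrm_le HVh).
Qed.

(** Strang-type splitting through the Galerkin solution with the exact
    right-hand side: quasi-optimality handles the first part, and the second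
    part solves a discrete problem whose data is the difference of the
    right-hand sides. *)
Lemma galerkin_error_le g gh w wh c :
  carrier (antidual V) g -> carrier (antidual V) gh -> 0 <= c ->
  (forall phi, Vh phi -> normc (g phi - gh phi) <= c * nrm V phi) ->
  carrier V w -> (forall phi, carrier V phi -> a w phi = g phi) ->
  Vh wh -> (forall phi, Vh phi -> a wh phi = gh phi) ->
  nrm V (w - wh) <= Cqo * dist V Vh w + Mlin * c.
Proof.
move=> gV ghV c0 gc Vw aw Vwh awh.
have [z [Vz az] _] := dstab (antidual_restrict subVh gV).
have Vzwh : Vh (z - wh) by exact: (carrierB HVh).
rewrite -{1}[w](subrK z) -addrA; apply: le_trans (nrmD HV _ (VhV Vzwh)) _.
  by apply: (carrierB HV) => //; exact: VhV.
apply: lerD; first exact: (qopt gV Vw Vz aw az).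
apply: (discrete_solution_le (g := fun phi => g phi - gh phi)) => //.
  by apply: antidualB; exact: antidual_restrict.
move=> phi Vphi; case: stab => iso _.
by rewrite (isomorphismB HV iso) ?az ?awh//; exact: VhV.
Qed.

End galerkin_step.

(** * The error recursion *)

(** Substituting the bound for d into the one for e leaves a scalar affine
    recursion of rate q, solved by variation of constants. *)
Lemma coupled_error_recursion (R : realType) (e d s1 s2 : nat -> R)
    (C alpha beta theta q : R) :
  0 <= alpha -> 0 <= beta -> 0 <= q -> q = theta + alpha * beta ->
  (forall n, d n <= C * s2 n + beta * e n) ->
  (forall n, e n.+1 <= C * s1 n.+1 + theta * e n + alpha * d n) ->
  forall n, e n + d n <= (1 + beta) * q ^+ n * e 0%N
    + C * (1 + beta) * (\sum_(1 <= k < n.+1) q ^+ (n - k) * s1 k)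
    + C * (1 + beta) * alpha * (\sum_(0 <= m < n) q ^+ (n - 1 - m) * s2 m)
    + C * s2 n.
Proof.
move=> a0 b0 q0 qE dle ele n.
have en : e n <= q ^+ n * e 0%N
    + C * (\sum_(1 <= k < n.+1) q ^+ (n - k) * s1 k)
    + C * alpha * (\sum_(0 <= m < n) q ^+ (n - 1 - m) * s2 m).
  elim: n => [|n IH].
    by rewrite expr0 mul1r !big_geq// !mulr0 !addr0.
  rewrite big_nat_recr//= [in X in _ <= _ + X]big_nat_recr//=.
  rewrite subnn expr0 mul1r.
  have -> : (n.+1 - 1 - n = 0)%N by rewrite subn1 subnn.
  rewrite expr0 mul1r.
  have -> : \sum_(1 <= k < n.+1) q ^+ (n.+1 - k) * s1 k =
            q * \sum_(1 <= k < n.+1) q ^+ (n - k) * s1 k.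
    rewrite big_distrr/=; apply: eq_big_nat => k /andP[_ kn].
    by rewrite subSn// exprS mulrA.
  have -> : \sum_(0 <= m < n) q ^+ (n.+1 - 1 - m) * s2 m =
            q * \sum_(0 <= m < n) q ^+ (n - 1 - m) * s2 m.
    rewrite big_distrr/=; apply: eq_big_nat => k /andP[_ kn].
    rewrite mulrA -exprS; congr (_ ^+ _ * _).
    by rewrite subSS subn0 -subnDA add1n subnSK.
  apply: le_trans (ele n) _.
  have := ler_wpM2l a0 (dle n); have := ler_wpM2l q0 IH.
  rewrite exprS; set S1 := \sum_(1 <= k < _) _; set S2 := \sum_(0 <= m < _) _.
  have : q * e n = theta * e n + alpha * beta * e n by rewrite {1}qE mulrDl.
  by move: (q ^+ n) => p; rewrite !mulrDr; lra.
have := ler_wpM2l (addr_ge0 ler01 b0) en; have := dle n.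
by rewrite !mulrDr !mulrDl !mul1r; lra.
Qed.

(** * Lebesgue measure on R^n *)

Section euclidean_measure.
Variables (R : realType) (n : nat).
Implicit Types (U : set 'rV[R]_n) (f : 'rV[R]_n -> R) (r : R).

Definition box (c : 'rV[R]_n) r : set 'rV[R]_n :=
  [set x | forall i, `|x 0 i - c 0 i| <= r].

Lemma measurable_box c r : measurable (box c r).
Proof.
have -> : box c r =
    \bigcap_i ((fun x : 'rV[R]_n => x 0 i) @^-1` `[c 0 i - r, c 0 i + r]).
  apply/seteqP; split => x /= H i.
    by move=> _ /=; rewrite in_itv/= -ler_distl.
  by have := H i I; rewrite /= in_itv/= -ler_distl.
apply: fin_bigcap_measurable; first exact: finite_finset.
move=> i _; rewrite -[X in measurable X]setTI.
by apply: measurable_coord => //; exact: measurable_itv.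
Qed.

(** Every open set is the countable union of the boxes with rational centre and
    radius 1/(k+1) that it contains. *)
Lemma open_rV_measurable U : open U -> measurable U.
Proof.
move=> oU.
pose Q (p : 'rV[rat]_n * nat) := box (map_mx ratr p.1) p.2.+1%:R^-1.
have -> : U = \bigcup_p (if `[< Q p `<=` U >] then Q p else set0).
  apply/seteqP; split => [x Ux|x [p _]]; last first.
    by case: asboolP => // QU /QU.
  have /nbhs_ballP[e /= e0 eU] := open_nbhs_nbhs (conj oU Ux).
  have [k] := ltr_add_invr (divr_gt0 e0 (ltr0Sn R 1)); rewrite add0r => ke.
  have k0 : 0 < k.+1%:R^-1 :> R by rewrite invr_gt0.
  have /choice[q qP] : forall i, exists q : rat, `|x 0 i - ratr q| < k.+1%:R^-1.
    move=> i; have [|q] := @rat_in_itvoo R (x 0 i - k.+1%:R^-1) (x 0 i + k.+1%:R^-1).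
      by rewrite ltrBlDr -addrA ltrDl addr_gt0.
    by rewrite in_itv/= -ltr_distl distrC => xq; exists q.
  exists (\row_i q i, k) => //; case: asboolP => [_ i|].
    by rewrite !mxE ltW.
  case=> y yQ; apply: eU; split=> // i j; rewrite (ord1 i).
  rewrite /ball/= (le_lt_trans (ler_distD (ratr (q j)) _ _))// [ltRHS]splitr.
  have qx : `|x 0 j - ratr (q j)| < e / 2 by apply: lt_trans (qP j) ke.
  have qy : `|ratr (q j) - y 0 j| < e / 2.
    by have := yQ j; rewrite !mxE distrC => /le_lt_trans/(_ ke).
  exact: ltrD qx qy.
apply: countable_bigcupT_measurable => [|p]; first exact: countableP.
by case: asboolP => // _; exact: measurable_box.
Qed.

Lemma continuous_rV_measurable f : continuous f -> measurable_fun [set: 'rV[R]_n] f.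
Proof.
move=> /continuousP cf.
apply: (measurability _ (RGenOpens.measurableE R)).
move=> _ [_ [a [b ->] <-]]; rewrite setTI; apply: open_rV_measurable.
exact/cf/interval_open.
Qed.

Lemma eball_box r : eball r `<=` box 0 r.
Proof.
move=> x /= xr i; rewrite mxE subr0; apply: le_trans (ltW xr).
rewrite -sqrtr_sqr ler_wsqrtr// /dot (bigD1 i)//= -expr2 lerDl.
by apply: sumr_ge0 => j _; rewrite -expr2 sqr_ge0.
Qed.

(** The ball lies in a closed box, which is compact. *)
Lemma continuous_eball_bounded f r : continuous f ->
  exists M, forall x, eball r x -> `|f x| <= M.
Proof.
move=> cf.
have cB : compact (box 0 r).
  have := @rV_compact R n (fun=> `[- r, r]%classic) (fun=> @segment_compact R _ _).
  congr compact; apply/seteqP; split => x /= H i; have := H i;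
    by rewrite in_itv/= mxE subr0 ler_norml.
have /compact_bounded [M [_ fM]] : compact (f @` box 0 r).
  by apply: continuous_compact => //; exact: continuous_subspaceT.
exists (M + 1) => x /eball_box xr; apply: (fM (M + 1)); first by rewrite ltrDl.
by exists x.
Qed.

End euclidean_measure.

Lemma leb_box_lty (R : realType) n (r : R) : (leb R n (box 0 r) < +oo)%E.
Proof.
elim: n => [|n IH].
  by rewrite /= diracE ltry.
rewrite /= /image_measure/= /pushforward.
have -> : @row_rcons R n @^-1` box 0 r =
    box 0 r `*` (`[- r, r]%classic : set (measurableTypeR R)).
  apply/seteqP; split => [[x y] /= H|[x y] /= [H1 H2] i].
    split=> /= [i|].
      by have := H (lift ord_max i); rewrite !mxE liftK.
    by have := H ord_max; rewrite !mxE unlift_none/= subr0 in_itv/= ler_norml.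
  rewrite !mxE subr0; case: unliftP => [j _|_] /=.
    by have := H1 j; rewrite mxE subr0.
  by move: H2; rewrite in_itv/= ler_norml.
rewrite product_measure1E//; last exact: measurable_box.
apply: lte_mul_pinfty => //.
  by rewrite ge0_fin_numE.
have := @lebesgue_measure_itv R `[- r, r] => /= ->.
by case: ifPn => // _; rewrite -EFinD ltry.
Qed.

Lemma leb_eball_lty (R : realType) n (r : R) : (leb R n (eball r) < +oo)%E.
Proof.
apply: le_lt_trans (leb_box_lty n r); apply: le_measure; rewrite ?inE.
- exact: measurable_eball.
- exact: measurable_box.
- exact: eball_box.
Qed.

(** * Complex-valued integrals *)

Section complex_integral.
Context d (T : measurableType d) (R : realType).
Variables (mu : {measure set T -> \bar R}) (A : set T).
Hypothesis mA : measurable A.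
Implicit Types f g : T -> R[i].

Definition cintegrable f :=
  mu.-integrable A (EFin \o (fun x => complex.Re (f x))) /\
  mu.-integrable A (EFin \o (fun x => complex.Im (f x))).

Lemma cmeasurableM f g :
  cmeasurable A f -> cmeasurable A g -> cmeasurable A (fun x => f x * g x).
Proof.
move=> [f1 f2] [g1 g2]; split.
  under eq_fun do rewrite ReM.
  by apply: measurable_funB; exact: measurable_funM.
under eq_fun do rewrite ImM.
by apply: measurable_funD; exact: measurable_funM.
Qed.

Lemma cmeasurableD f g :
  cmeasurable A f -> cmeasurable A g -> cmeasurable A (fun x => f x + g x).
Proof.
move=> [f1 f2] [g1 g2]; split.
  by under eq_fun do rewrite ReD; exact: measurable_funD.
by under eq_fun do rewrite ImD; exact: measurable_funD.
Qed.

Lemma cmeasurable_conj f : cmeasurable A f -> cmeasurable A (fun x => (f x)^*).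
Proof.
move=> [f1 f2]; split.
  rewrite (_ : (fun _ => _) = fun x => complex.Re (f x))//.
  by apply/funext => x; case: (f x).
rewrite (_ : (fun _ => _) = fun x => - complex.Im (f x)).
  exact: measurableT_comp.
by apply/funext => x; case: (f x).
Qed.

Lemma cmeasurable_real (h : T -> R) :
  measurable_fun A h -> cmeasurable A (fun x => (h x)%:C).
Proof. by move=> mh; split => //=; exact: measurable_cst. Qed.

Lemma cmeasurable_cst (c : R[i]) : cmeasurable A (fun=> c).
Proof. by split; exact: measurable_cst. Qed.

Lemma measurable_sqr_normc f :
  cmeasurable A f -> measurable_fun A (fun x => normc (f x) ^+ 2).
Proof.
move=> [f1 f2]; under eq_fun do rewrite sqr_normcE.
by apply: measurable_funD; exact: measurable_funX.
Qed.

Lemma measurable_normc f :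
  cmeasurable A f -> measurable_fun A (fun x => normc (f x)).
Proof.
move=> mf; under eq_fun do rewrite normcE -sqr_normcE.
apply: (measurableT_comp (continuous_measurable_fun (@sqrt_continuous R))).
exact: measurable_sqr_normc.
Qed.

Lemma cintegrable_dominated f (h : T -> R) :
  cmeasurable A f -> mu.-integrable A (EFin \o h) ->
  (forall x, A x -> normc (f x) <= h x) -> cintegrable f.
Proof.
move=> [f1 f2] ih fh; split; apply: le_integrable ih => //.
- exact/measurable_EFinP.
- move=> x Ax; rewrite /= lee_fin (le_trans (Re_le_normc _))//.
  exact: le_trans (fh _ Ax) (ler_norm _).
- exact/measurable_EFinP.
- move=> x Ax; rewrite /= lee_fin (le_trans (Im_le_normc _))//.
  exact: le_trans (fh _ Ax) (ler_norm _).
Qed.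

Lemma eq_cint f g : (forall x, A x -> f x = g x) -> cint mu A f = cint mu A g.
Proof.
by move=> fg; congr (_ +i* _); apply: eq_Rintegral => x /set_mem Ax; rewrite fg.
Qed.

Lemma cintegrableZ (c : R[i]) f : cintegrable f -> cintegrable (fun x => c * f x).
Proof.
move=> [f1 f2]; split.
  apply: (eq_integrable mA _ _ _
    (integrableB mA (integrableZl mA (complex.Re c) f1)
      (integrableZl mA (complex.Im c) f2))) => x _ /=.
  by rewrite ReM.
apply: (eq_integrable mA _ _ _
    (integrableD mA (integrableZl mA (complex.Re c) f2)
      (integrableZl mA (complex.Im c) f1))) => x _ /=.
by rewrite ImM.
Qed.

Lemma cintD f g : cintegrable f -> cintegrable g ->
  cint mu A (fun x => f x + g x) = cint mu A f + cint mu A g.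
Proof.
move=> [f1 f2] [g1 g2]; rewrite /cint.
under [X in X +i* _]eq_Rintegral do rewrite ReD.
under [X in _ +i* X]eq_Rintegral do rewrite ImD.
by rewrite !RintegralD.
Qed.

Lemma cintZ (c : R[i]) f : cintegrable f ->
  cint mu A (fun x => c * f x) = c * cint mu A f.
Proof.
move=> [f1 f2]; rewrite /cint.
under [X in X +i* _]eq_Rintegral do rewrite ReM.
under [X in _ +i* X]eq_Rintegral do rewrite ImM.
have iZ (r : R) (h : T -> R) : mu.-integrable A (EFin \o h) ->
    mu.-integrable A (EFin \o (fun x => r * h x)).
  by move=> ih; apply: (eq_integrable mA _ _ _ (integrableZl mA r ih)).
rewrite RintegralB ?RintegralD ?RintegralZl//; try exact: iZ.
by case: c => a b.
Qed.

(** Multiplying by the conjugate of I, the value of the integral, turns |I|^2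
    into the integral of a real function bounded by |I| |f|. *)
Lemma normc_cint_le f (h : T -> R) : cmeasurable A f ->
  mu.-integrable A (EFin \o h) -> (forall x, A x -> normc (f x) <= h x) ->
  normc (cint mu A f) <= \int[mu]_(x in A) h x.
Proof.
move=> mf ih fh; have intf := cintegrable_dominated mf ih fh.
set I := cint mu A f.
have [I0|I0] := eqVneq (normc I) 0.
  rewrite I0; apply: Rintegral_ge0 => x Ax.
  exact: le_trans (normc_ge0 _) (fh _ Ax).
have Igt0 : 0 < normc I by rewrite lt_neqAle eq_sym I0 normc_ge0.
rewrite -(ler_pM2l Igt0) -expr2.
have -> : normc I ^+ 2 = complex.Re (cint mu A (fun x => I^* * f x)).
  by rewrite cintZ// -/I sqr_normcE; case: I {I0 Igt0} => a b /=; ring.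
rewrite /cint/= -RintegralZl//.
have [iIf _] := cintegrableZ I^* intf.
apply: le_Rintegral => //.
  by apply: (eq_integrable mA _ _ _ (integrableZl mA (normc I) ih)).
move=> x Ax; apply: le_trans (ler_norm _) _.
rewrite (le_trans (Re_le_normc _))// normcM normc_conj.
by rewrite ler_wpM2l ?normc_ge0 ?fh.
Qed.

End complex_integral.

(** * Hoelder estimates *)

Section hoelder_estimates.
Context d (T : measurableType d) (R : realType).
Variable mu : {measure set T -> \bar R}.
Implicit Types (f g h : T -> R) (A : set T).
Local Open Scope ereal_scope.

Lemma Lnorm2_sqr f : 'N[mu]_2%:E[EFin \o (fun x => f x ^+ 2)%R] `^ 2^-1 =
  'N[mu]_4%:E[EFin \o f].
Proof.
rewrite unlock -poweRrM; congr (_ `^ _); last by lra.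
apply: eq_integral => x _ /=.
by rewrite normrX !powR_mulrn ?exprn_ge0// -exprM.
Qed.

(** Cauchy-Schwarz twice: once to separate h, once on f^2 g^2. *)
Lemma hoelder_422 f g h : measurable_fun setT f -> measurable_fun setT g ->
  measurable_fun setT h ->
  'N[mu]_1[EFin \o (fun x => f x * g x * h x)%R] <=
  'N[mu]_4%:E[EFin \o f] * 'N[mu]_4%:E[EFin \o g] * 'N[mu]_2%:E[EFin \o h].
Proof.
move=> mf mg mh.
have half : (2^-1 + 2^-1 = 1 :> R)%R by lra.
apply: le_trans (hoelder mu (measurable_funM mf mg) mh _ _ half) _ => //.
apply: lee_wpmul2r; first exact: Lnorm_ge0.
rewrite -!Lnorm2_sqr -poweRM ?Lnorm_ge0//.
have -> : 'N[mu]_2%:E[EFin \o (f \* g)%R] =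
    'N[mu]_1[EFin \o ((fun x => f x ^+ 2) \* (fun x => g x ^+ 2))%R] `^ 2^-1.
  rewrite Lnorm1 unlock; congr (_ `^ _); apply: eq_integral => x _ /=.
  by rewrite powR_mulrn// -exprMn normrX.
have itv0 (x : \bar R) : 0 <= x -> x \in `[0, +oo%E]%R.
  by move=> x0; rewrite in_itv/= x0 leey.
apply: gt0_ler_poweR => //; first by apply: itv0; exact: Lnorm_ge0.
  by apply: itv0; apply: mule_ge0; exact: Lnorm_ge0.
by apply: hoelder => //; exact: measurable_funX.
Qed.

(** The essential supremum is attained as a bound almost everywhere; its
    finiteness on A comes from that on the whole space. *)
Lemma ae_le_Lp_norm_oo A f : Lp_norm mu +oo setT f < +oo ->
  {ae mu, forall x, A x -> (`|f x| <= fine (Lp_norm mu +oo A f))%R}.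
Proof.
rewrite /Lp_norm unlock; case: ifPn => [mu0 fT|].
  have fA : ess_sup_inf.ess_sup mu (abse \o (EFin \o f) \_ A) < +oo.
    apply: le_lt_trans fT; apply: ess_sup_inf.le_ess_sup; apply: nearW => x /=.
    by rewrite !patchE in_setT; case: ifPn => //= _; rewrite normr0 lee_fin.
  apply: filterS (ess_sup_inf.ess_sup_ge mu (abse \o (EFin \o f) \_ A)) => x /= + Ax.
  rewrite patchE mem_set//= => fx.
  rewrite -lee_fin fineK// ge0_fin_numE//; exact: le_trans fx.
rewrite -leNgt => mu0 _; exists setT; split => //.
by apply/eqP; rewrite eq_le mu0/=.
Qed.

End hoelder_estimates.

(** * The space H^1 of a ball *)

Section sobolev_space.
Variables (R : realType) (d : nat) (r : R).
Local Notation B := (@eball R d r).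
Local Notation mu := (leb R d).
Local Notation V := (@H1 R d B).
Implicit Types (v w : sob R d) (phi : 'rV[R]_d -> R).

Let mB : measurable B := measurable_eball r.

Lemma sob_density_ge0 v x : 0 <= sob_density v x.
Proof. by rewrite /sob_density addr_ge0 ?sumr_ge0// => *; exact: sqr_ge0. Qed.

(** The pointwise form of the triangle inequality, with a free parameter that
    is optimized only after integration. *)
Lemma sob_densityD t v w x : 0 < t ->
  sob_density (v + w) x <= (1 + t) * sob_density v x + (1 + t^-1) * sob_density w x.
Proof.
move=> t0.
have cauchy (z z' : R[i]) :
    normc (z + z') ^+ 2 <= (1 + t) * normc z ^+ 2 + (1 + t^-1) * normc z' ^+ 2.
  have real (a b : R) : (a + b) ^+ 2 <= (1 + t) * a ^+ 2 + (1 + t^-1) * b ^+ 2.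
    (* the difference of the two sides is a multiple of a square *)
    rewrite -subr_ge0.
    have -> : (1 + t) * a ^+ 2 + (1 + t^-1) * b ^+ 2 - (a + b) ^+ 2 =
        t^-1 * (t * a - b) ^+ 2 by field; rewrite gt_eqF.
    by rewrite mulr_ge0 ?sqr_ge0// invr_ge0 ltW.
  rewrite !sqr_normcE ReD ImD.
  have := real (complex.Re z) (complex.Re z').
  have := real (complex.Im z) (complex.Im z').
  by lra.
rewrite /sob_density !mulrDr addrACA; apply: lerD; first exact: cauchy.
by rewrite !mulr_sumr -big_split/=; apply: ler_sum => i _; rewrite mxE; exact: cauchy.
Qed.

Lemma sob_densityZ (a : R[i]) v x :
  sob_density (a *: v) x = normc a ^+ 2 * sob_density v x.
Proof.
rewrite /sob_density mulrDr mulr_sumr; congr (_ + _).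
  by rewrite -exprMn -normcM.
by apply: eq_bigr => i _; rewrite mxE normcM exprMn.
Qed.

Lemma sob_density_integrable v : carrier V v ->
  mu.-integrable B (EFin \o sob_density v).
Proof.
move=> [m1 m2 fin _]; apply/integrableP; split.
  apply/measurable_EFinP; apply: measurable_funD; first exact: measurable_sqr_normc.
  by apply: measurable_sum => i; exact: measurable_sqr_normc.
by under eq_integral do rewrite /= ger0_norm ?sob_density_ge0//.
Qed.

Lemma sob_cmeasurableD (a : R[i]) v w : carrier V v -> carrier V w ->
  cmeasurable B (a *: v + w).1 /\
  forall i, cmeasurable B (fun x => (a *: v + w).2 x 0 i).
Proof.
move=> [v1 v2 _ _] [w1 w2 _ _]; split=> [|i].
  by apply: cmeasurableD => //; apply: cmeasurableM => //; exact: cmeasurable_cst.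
rewrite (_ : (fun _ => _) = fun x => a * v.2 x 0 i + w.2 x 0 i).
  by apply: cmeasurableD => //; apply: cmeasurableM => //; exact: cmeasurable_cst.
by apply/funext => x; rewrite !mxE.
Qed.

(** This is applied to test functions and their derivatives, which are continuous
    on the whole space and hence bounded on the ball; as the ball has finite
    volume, square integrability of f gives integrability of the product. *)
Lemma continuous_cintegrable (f : 'rV[R]_d -> R[i]) phi v :
  carrier V v -> cmeasurable B f ->
  (forall x, normc (f x) ^+ 2 <= sob_density v x) ->
  (forall x, {for x, continuous phi}) ->
  cintegrable mu B (fun x => f x * (phi x)%:C).
Proof.
move=> Vv mf fv cphi; have [M phiM] := continuous_eball_bounded r cphi.
have mphi := continuous_rV_measurable cphi.
have i1 : mu.-integrable B (EFin \o cst 1).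
  apply: measurable_bounded_integrable => //; first exact: leb_eball_lty.
  by exists 1; split=> // x x1 y _; rewrite /= normr1 ltW.
apply: (@cintegrable_dominated _ _ _ _ _ mB _ (fun x => `|M| * (sob_density v x + 1))).
- apply: cmeasurableM => //; apply: cmeasurable_real.
  exact: measurable_funS mphi.
- apply: (eq_integrable mB _ _ _ (integrableZl mB `|M| (integrableD mB
    (sob_density_integrable Vv) i1))) => //.
- move=> x Bx; rewrite normcM normc_real mulrC ler_pM ?normc_ge0//.
    exact: le_trans (phiM _ Bx) (ler_norm _).
  apply: le_trans (_ : normc (f x) ^+ 2 + 1 <= _); last by rewrite lerD2r.
  by have := sqr_ge0 (normc (f x) - 1 / 2); rewrite !expr2; lra.
Qed.

Lemma normc_le_density v x : normc (v.1 x) ^+ 2 <= sob_density v x.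
Proof. by rewrite /sob_density lerDl sumr_ge0// => *; exact: sqr_ge0. Qed.

Lemma normc_grad_le_density v x i : normc (v.2 x 0 i) ^+ 2 <= sob_density v x.
Proof.
rewrite /sob_density (bigD1 i)//= addrCA lerDl addr_ge0 ?sqr_ge0//.
by apply: sumr_ge0 => *; exact: sqr_ge0.
Qed.

(** The two integrals in the defining identity are finite, so the identity can
    be combined linearly. *)
Lemma weak_gradientD (a : R[i]) v w : carrier V v -> carrier V w ->
  weak_gradient B (a *: v + w).
Proof.
move=> Vv Vw phi tphi i; have [sphi _ _] := tphi.
have [v1 v2 _ gv] := Vv; have [w1 w2 _ gw] := Vw.
have cphi x : {for x, continuous phi} := sphi 0%N x I.
have cdphi x : {for x, continuous (partial i phi)} := (sphi 1%N i).2 x I.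
have iv := continuous_cintegrable Vv v1 (normc_le_density v) cdphi.
have iw := continuous_cintegrable Vw w1 (normc_le_density w) cdphi.
have igv := continuous_cintegrable Vv (v2 i) (normc_grad_le_density v ^~ i) cphi.
have igw := continuous_cintegrable Vw (w2 i) (normc_grad_le_density w ^~ i) cphi.
rewrite (@eq_cint _ _ _ mu B _ (fun x => a * (v.1 x * (partial i phi x)%:C) +
    w.1 x * (partial i phi x)%:C)); last first.
  by move=> x _; rewrite mulrA -mulrDl.
rewrite [X in _ = - X](@eq_cint _ _ _ mu B _ (fun x => a * (v.2 x 0 i * (phi x)%:C) +
    w.2 x 0 i * (phi x)%:C)); last first.
  by move=> x _; rewrite !mxE mulrA -mulrDl.
have cZ := cintegrableZ mB a.
rewrite !(cintD mB) ?(cintZ mB)//; try exact: cZ.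
by rewrite (gv _ tphi i) (gw _ tphi i) opprD mulrN.
Qed.

Lemma H1_linear (a : R[i]) v w : carrier V v -> carrier V w -> carrier V (a *: v + w).
Proof.
move=> Vv Vw; have [m1 m2] := sob_cmeasurableD a Vv Vw.
split => //; last exact: weak_gradientD.
have iv := sob_density_integrable Vv; have iw := sob_density_integrable Vw.
have := integrableD mB (integrableZl mB ((1 + 1) * normc a ^+ 2) iv)
  (integrableZl mB (1 + 1^-1) iw).
move=> /integrableP[mf]; apply: le_lt_trans; apply: ge0_le_integral => //.
- by move=> x _; rewrite lee_fin sob_density_ge0.
- apply/measurable_EFinP; apply: measurable_funD; first exact: measurable_sqr_normc.
  by apply: measurable_sum => i; exact: measurable_sqr_normc.
- exact: measurableT_comp mf.
- move=> x _ /=; rewrite lee_fin; apply: le_trans (ler_norm _).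
  by have := sob_densityD (a *: v) w x (@ltr01 R); rewrite sob_densityZ mulrA.
Qed.

Lemma H1_carrier0 : carrier V 0.
Proof.
have c0 : cint mu B (fun=> 0) = 0.
  by rewrite /cint /Rintegral /= integral0.
split=> [|i||phi _ i].
- exact: cmeasurable_cst.
- rewrite (_ : (fun _ => _) = fun=> 0); first exact: cmeasurable_cst.
  by apply/funext => x; rewrite mxE.
- rewrite (eq_integral (cst 0%E)) ?integral0// => x _.
  have := sob_densityZ 0 0 x; rewrite scale0r normc0 expr0n mul0r => ->.
  by [].
- rewrite (@eq_cint _ _ _ mu B _ (fun=> 0)); last by move=> x _; rewrite /= mul0r.
  rewrite [X in _ = - X](@eq_cint _ _ _ mu B _ (fun=> 0)); last first.
    by move=> x _; rewrite /= mxE mul0r.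
  by rewrite c0 oppr0.
Qed.

Lemma H1_nrmE v : nrm V v ^+ 2 = \int[mu]_(x in B) sob_density v x.
Proof.
by rewrite /= sqr_sqrtr//; apply: Rintegral_ge0 => x _; exact: sob_density_ge0.
Qed.

Lemma H1_nrmZ (a : R[i]) v : carrier V v -> nrm V (a *: v) = normc a * nrm V v.
Proof.
move=> Vv /=; have -> : \int[mu]_(x in B) sob_density (a *: v) x =
    normc a ^+ 2 * \int[mu]_(x in B) sob_density v x.
  rewrite -RintegralZl//; last exact: sob_density_integrable.
  by apply: eq_Rintegral => x _; rewrite sob_densityZ.
by rewrite sqrtrM ?sqr_ge0// sqrtr_sqr ger0_norm ?normc_ge0.
Qed.

(** With t = nrm w / nrm v the two weighted terms add up to the square of the sum
    of the norms; enlarging both norms by e / 2 > 0 avoids dividing by zero. *)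
Lemma H1_nrmD v w : carrier V v -> carrier V w ->
  nrm V (v + w) <= nrm V v + nrm V w.
Proof.
move=> Vv Vw; apply/ler_addgt0Pl => e e0.
have Vvw : carrier V (v + w) by rewrite -[v]scale1r; exact: H1_linear.
have nn u : 0 <= nrm V u by exact: sqrtr_ge0.
pose a := nrm V v + e / 2; pose b := nrm V w + e / 2.
have a0 : 0 < a by rewrite ltr_wpDl ?divr_gt0.
have b0 : 0 < b by rewrite ltr_wpDl ?divr_gt0.
have -> : e + (nrm V v + nrm V w) = a + b by rewrite /a /b; lra.
rewrite -(ler_pXn2r (ltn0Sn 1)) ?nnegrE//; last by rewrite ltW// addr_gt0.
have t0 : 0 < b / a by rewrite divr_gt0.
have iv := sob_density_integrable Vv; have iw := sob_density_integrable Vw.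
have iZ (c : R) u : carrier V u ->
    mu.-integrable B (EFin \o (fun x => c * sob_density u x)).
  move=> /sob_density_integrable iu.
  by apply: (eq_integrable mB _ _ _ (integrableZl mB c iu)).
apply: le_trans (_ : (1 + b / a) * nrm V v ^+ 2 + (1 + (b / a)^-1) * nrm V w ^+ 2 <= _).
  rewrite !H1_nrmE -!RintegralZl// -RintegralD//; try exact: iZ.
  apply: le_Rintegral => //; first exact: sob_density_integrable.
    by apply: (eq_integrable mB _ _ _ (integrableD mB (iZ _ _ Vv) (iZ _ _ Vw))).
  by move=> x _; exact: sob_densityD.
apply: le_trans (_ : (1 + b / a) * a ^+ 2 + (1 + (b / a)^-1) * b ^+ 2 <= _).
  apply: lerD; apply: ler_wpM2l.
  - by rewrite addr_ge0// ltW.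
  - by rewrite ler_pXn2r ?nnegrE ?(ltW a0)// lerDl divr_ge0// ltW.
  - by rewrite addr_ge0// invr_ge0 ltW.
  - by rewrite ler_pXn2r ?nnegrE ?(ltW b0)// lerDl divr_ge0// ltW.
by rewrite le_eqVlt; apply/orP; left; apply/eqP; field; rewrite !gt_eqF.
Qed.

Lemma H1_seminorm_laws : seminorm_laws V.
Proof.
split; [exact: H1_carrier0|exact: H1_linear|exact: H1_nrmZ|exact: H1_nrmD].
Qed.

End sobolev_space.

(** * The quadratic source terms *)

Section source_functional.
Variables (R : realType) (d : nat) (rad Cprod K : R) (chi : 'rV[R]_d -> R).
Local Notation B := (@eball R d rad).
Local Notation mu := (leb R d).
Local Notation V := (@H1 R d B).
Hypothesis hprod : @product_constant R d rad Cprod.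
Hypothesis mchi : measurable_fun B chi.
Hypothesis chi_le : {ae mu, forall x, B x -> `|chi x| <= K}.
Hypothesis K_ge0 : 0 <= K.
Implicit Types (p : 'rV[R]_d -> R[i]) (w z phi : sob R d).

Let mB : measurable B := measurable_eball rad.

Definition source p phi : R[i] :=
  cint mu B (fun x => (chi x)%:C * p x * (phi.1 x)^*).

(** The nonlinearities are products of two factors in V, possibly conjugated, and
    only the moduli of the factors enter the estimates. *)
Definition product_dominated p w z :=
  [/\ carrier V w, carrier V z, cmeasurable B p &
      forall x, normc (p x) <= normc (w.1 x) * normc (z.1 x)].

Lemma Lp_norm_restrict (s : \bar R) (f : 'rV[R]_d -> R) :
  Lp_norm mu s B f = 'N[mu]_s[EFin \o (f \_ B)]%E.
Proof.
rewrite /Lp_norm; congr Lnorm; apply/funext => x.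
by rewrite /= !patchE; case: ifP.
Qed.

(** All integrals over the ball become integrals over the whole space of
    functions extended by zero, which is how the Lebesgue norms in the product
    constant are defined. *)
Lemma triple_integral_le w z phi :
  carrier V w -> carrier V z -> carrier V phi ->
  (\int[mu]_(x in B) (normc (w.1 x) * normc (z.1 x) * normc (phi.1 x))%:E
   <= (Cprod * nrm V w * nrm V z * nrm V phi)%:E)%E.
Proof.
move=> Vw Vz Vphi; apply: le_trans (hprod Vw Vz Vphi).
have mN v : carrier V v -> measurable_fun setT ((fun x => normc (v.1 x)) \_ B).
  by move=> [mv _ _ _]; apply/(measurable_restrictT _ mB); exact: measurable_normc.
rewrite !Lp_norm_restrict.
apply: le_trans (hoelder_422 mu (mN _ Vw) (mN _ Vz) (mN _ Vphi)).
rewrite Lnorm1 [leLHS]integral_mkcond.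
rewrite le_eqVlt; apply/orP; left; apply/eqP; apply: eq_integral => x _.
rewrite /= !patchE; case: ifP => _; last by rewrite !mulr0 normr0.
by rewrite ger0_norm// !mulr_ge0 ?normc_ge0.
Qed.

Lemma source_integrand_cmeasurable p w z phi :
  product_dominated p w z -> carrier V phi ->
  cmeasurable B (fun x => (chi x)%:C * p x * (phi.1 x)^*).
Proof.
move=> [_ _ mp _] [mphi _ _ _]; apply: cmeasurableM; last exact: cmeasurable_conj.
by apply: cmeasurableM => //; exact: cmeasurable_real.
Qed.

Lemma source_integrand_le p w z phi :
  product_dominated p w z -> carrier V phi ->
  (\int[mu]_(x in B) (normc ((chi x)%:C * p x * (phi.1 x)^*))%:E
   <= (K * Cprod * nrm V w * nrm V z * nrm V phi)%:E)%E.
Proof.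
move=> pwz Vphi; have mf := source_integrand_cmeasurable pwz Vphi.
case: pwz => Vw Vz mp ple.
have mN v : carrier V v -> measurable_fun B (fun x => normc (v.1 x)).
  by move=> [mv _ _ _]; exact: measurable_normc.
have mwzp : measurable_fun B
    (fun x => (normc (w.1 x) * normc (z.1 x) * normc (phi.1 x))%:E).
  apply/measurable_EFinP; apply: measurable_funM; last exact: mN.
  by apply: measurable_funM; exact: mN.
have wzp0 x : (0 <= (normc (w.1 x) * normc (z.1 x) * normc (phi.1 x))%:E)%E.
  by rewrite lee_fin !mulr_ge0 ?normc_ge0.
apply: le_trans (_ : (\int[mu]_(x in B) (K%:E *
    (normc (w.1 x) * normc (z.1 x) * normc (phi.1 x))%:E) <= _)%E).
  apply: ae_ge0_le_integral => //.
  - by move=> x _; rewrite lee_fin normc_ge0.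
  - by apply/measurable_EFinP; exact: measurable_normc.
  - by move=> x _; rewrite mule_ge0.
  - exact: measurable_funeM.
  - apply: filterS chi_le => x chiK Bx; rewrite -EFinM lee_fin.
    rewrite !normcM normc_conj normc_real !mulrA ler_wpM2r ?normc_ge0//.
    by rewrite -mulrA ler_pM ?normc_ge0 ?chiK.
rewrite ge0_integralZl//.
apply: le_trans (lee_wpmul2l _ (triple_integral_le Vw Vz Vphi)) _ => //.
by rewrite -EFinM !mulrA.
Qed.

Let integrable_normc p w z phi :
  product_dominated p w z -> carrier V phi ->
  mu.-integrable B (EFin \o (fun x => normc ((chi x)%:C * p x * (phi.1 x)^*))).
Proof.
move=> pwz Vphi; have mf := source_integrand_cmeasurable pwz Vphi.
apply/integrableP; split; first by apply/measurable_EFinP; exact: measurable_normc.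
under eq_integral do rewrite /= ger0_norm ?normc_ge0//.
by apply: le_lt_trans (source_integrand_le pwz Vphi) _; rewrite ltry.
Qed.

Lemma source_integrable p w z phi :
  product_dominated p w z -> carrier V phi ->
  cintegrable mu B (fun x => (chi x)%:C * p x * (phi.1 x)^*).
Proof.
move=> pwz Vphi; have mf := source_integrand_cmeasurable pwz Vphi.
exact: (cintegrable_dominated mB mf (integrable_normc pwz Vphi)).
Qed.

Lemma source_le p w z phi : product_dominated p w z -> carrier V phi ->
  normc (source p phi) <= K * Cprod * nrm V w * nrm V z * nrm V phi.
Proof.
move=> pwz Vphi; have mf := source_integrand_cmeasurable pwz Vphi.
have int := integrable_normc pwz Vphi.
apply: le_trans (normc_cint_le mB mf int _) _ => //.
rewrite -lee_fin /Rintegral fineK; first exact: source_integrand_le pwz Vphi.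
exact: integrable_fin_num.
Qed.

(** Stated for a pointwise decomposition of p, because it is used to expand a
    difference of products. *)
Lemma sourceD p p1 p2 w1 z1 w2 z2 phi :
  product_dominated p1 w1 z1 -> product_dominated p2 w2 z2 ->
  (forall x, p x = p1 x + p2 x) -> carrier V phi ->
  source p phi = source p1 phi + source p2 phi.
Proof.
move=> d1 d2 pE Vphi; rewrite /source -cintD//.
- by apply: eq_cint => x _; rewrite pE; ring.
- exact: source_integrable d1 Vphi.
- exact: source_integrable d2 Vphi.
Qed.

Lemma source_antidual p w z : product_dominated p w z ->
  carrier (antidual V) (source p).
Proof.
move=> pwz; split=> [a phi1 phi2 V1 V2|].
  have i1 := source_integrable pwz V1; have i2 := source_integrable pwz V2.
  rewrite /source -(cintZ mB _ i1) -cintD//; last exact: cintegrableZ.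
  apply: eq_cint => x _ /=; rewrite rmorphD rmorphM/=; ring.
exists (K * Cprod * nrm V w * nrm V z) => phi; exact: source_le.
Qed.

End source_functional.

Section product_terms.
Variables (R : realType) (d : nat) (rad : R).
Local Notation V := (@H1 R d (@eball R d rad)).
Implicit Types w z : sob R d.

Lemma product_dominatedM w z : carrier V w -> carrier V z ->
  product_dominated rad (fun x => w.1 x * z.1 x) w z.
Proof.
move=> Vw Vz; split=> // [|x]; last by rewrite normcM.
by case: Vw Vz => [mw _ _ _] [mz _ _ _]; exact: cmeasurableM.
Qed.

Lemma product_dominated_conj w z : carrier V w -> carrier V z ->
  product_dominated rad (fun x => (w.1 x)^* * z.1 x) w z.
Proof.
move=> Vw Vz; split=> // [|x]; last by rewrite normcM normc_conj.
case: Vw Vz => [mw _ _ _] [mz _ _ _].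
by apply: cmeasurableM => //; exact: cmeasurable_conj.
Qed.

Lemma product_dominated_sqr w : carrier V w ->
  product_dominated rad (fun x => w.1 x ^+ 2) w w.
Proof. by move=> Vw; exact: product_dominatedM. Qed.

End product_terms.

(** * The error estimate *)

Theorem theorem3p10 (R : realType) (d : nat) (hd : d = 2%N \/ d = 3%N)
  (D : set 'rV[R]_d) (rad : R)
  (hD : bounded_lipschitz_domain D) (hrad : 0 < rad)
  (hDB : closure D `<=` eball rad)
  (kappa1 : R) (hkappa1 : 0 < kappa1)
  (nmin nmax : R) (hnmin : 0 < nmin)
  (n1 n2 chi1 chi2 : 'rV[R]_d -> R)
  (hn1 : refractive_index rad D nmin nmax n1)
  (hn2 : refractive_index rad D nmin nmax n2)
  (hchi1 : susceptibility D chi1) (hchi2 : susceptibility D chi2)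
  (d0 : 'rV[R]_d) (hd0 : enorm d0 = 1)
  (gamma : sob R d -> 'rV[R]_d -> R[i])
  (hgamma : trace_operator rad gamma)
  (T1 T2 : ('rV[R]_d -> R[i]) -> ('rV[R]_d -> R[i]) -> R[i])
  (hT1 : dtn_map rad kappa1 T1) (hT2 : dtn_map rad (2 * kappa1) T2) :
  let V := H1 (eball rad) in
  let a1 := helmholtz_form rad kappa1 n1 T1 gamma in
  let a2 := helmholtz_form rad (2 * kappa1) n2 T2 gamma in
  let ell := fun xi => incident_flux rad kappa1 d0 T1 gamma (gamma xi) in
  forall (hell : carrier (antidual V) ell)
  (M1 M2 : R) (hM1 : 0 < M1) (hM2 : 0 < M2)
  (hA1 : continuous_stability V a1 M1) (hA2 : continuous_stability V a2 M2)
  (Cprod : R) (hCprod : 0 < Cprod) (hprod : @product_constant R d rad Cprod)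
  (p : nat) (hp : (1 <= p)%N)
  (Th : R -> mesh R d) (Vh : R -> set (sob R d))
  (hmesh : forall h, 0 < h -> conforming_mesh rad (Th h))
  (sreg : R) (hsreg : 0 < sreg)
  (hshape : forall h, 0 < h -> shape_regular sreg (Th h))
  (hVh : forall h, 0 < h -> fe_space rad p (Th h) (Vh h))
  (hdense : forall v, carrier V v -> dist V (Vh h) v @[h --> 0^'+] --> (0 : R))
  (h0 Mlin Cqo : R) (hh0 : 0 < h0) (hMlin : 0 < Mlin) (hCqo : 0 < Cqo)
  (hstab1 : forall h, 0 < h <= h0 -> discrete_stability V a1 (Vh h) Mlin)
  (hstab2 : forall h, 0 < h <= h0 -> discrete_stability V a2 (Vh h) Mlin)
  (hqo1 : forall h, 0 < h <= h0 -> quasi_optimality V a1 (Vh h) Cqo)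
  (hqo2 : forall h, 0 < h <= h0 -> quasi_optimality V a2 (Vh h) Cqo),
  let chi1_oo := fine (Lp_norm (leb R d) +oo (eball rad) chi1) in
  let chi2_oo := fine (Lp_norm (leb R d) +oo (eball rad) chi2) in
  let Mhat1 := Num.max M1 Mlin in
  let Mhat2 := Num.max M2 Mlin in
  let alpha := fun r : R => Mhat1 * Cprod * chi1_oo * r in
  let beta := fun r : R => 2 * Mhat2 * Cprod * chi2_oo * r in
  let sigma := fun r : R => beta r * r / 2 in
  let theta := fun r : R => Mhat1 * Cprod * chi1_oo * sigma r in
  let q := fun r : R => theta r + alpha r * beta r in
  forall (rho : R) (hrho : 0 < rho)
  (hball : Mhat1 * nrm (antidual V) ell + theta rho * rho <= rho)
  (hq : q rho < 1)
  (h : R) (hh : 0 < h <= h0)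
  (u1 u2 u1h u2h : nat -> sob R d)
  (hu1 : forall n, carrier V (u1 n)) (hu2 : forall n, carrier V (u2 n))
  (hu2E : forall n eta, carrier V eta ->
    a2 (u2 n) eta = cint (leb R d) (eball rad) (fun x =>
      (chi2 x)%:C * (u1 n).1 x ^+ 2 * (eta.1 x)^*))
  (hu1E : forall n xi, carrier V xi ->
    a1 (u1 n.+1) xi = cint (leb R d) (eball rad) (fun x =>
      (chi1 x)%:C * ((u1 n).1 x)^* * (u2 n).1 x * (xi.1 x)^*) + ell xi)
  (hu1h : forall n, Vh h (u1h n)) (hu2h : forall n, Vh h (u2h n))
  (hu2hE : forall n eta, Vh h eta ->
    a2 (u2h n) eta = cint (leb R d) (eball rad) (fun x =>
      (chi2 x)%:C * (u1h n).1 x ^+ 2 * (eta.1 x)^*))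
  (hu1hE : forall n xi, Vh h xi ->
    a1 (u1h n.+1) xi = cint (leb R d) (eball rad) (fun x =>
      (chi1 x)%:C * ((u1h n).1 x)^* * (u2h n).1 x * (xi.1 x)^*) + ell xi)
  (hinit : nrm V (u1 0%N) <= rho) (hinith : nrm V (u1h 0%N) <= rho),
  let eta1 := fun n => dist V (Vh h) (u1 n) in
  let eta2 := fun n => dist V (Vh h) (u2 n) in
  (forall n, [/\ nrm V (u1 n) <= rho, nrm V (u1h n) <= rho,
                 nrm V (u2 n) <= sigma rho & nrm V (u2h n) <= sigma rho]) /\
  (forall n,
    [/\ nrm V (u2 n - u2h n) <=
          Cqo * eta2 n + beta rho * nrm V (u1 n - u1h n),
        nrm V (u1 n.+1 - u1h n.+1) <=
          Cqo * eta1 n.+1 + theta rho * nrm V (u1 n - u1h n)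
          + alpha rho * nrm V (u2 n - u2h n) &
        nrm V (u1 n - u1h n) + nrm V (u2 n - u2h n) <=
          (1 + beta rho) * q rho ^+ n * nrm V (u1 0%N - u1h 0%N)
          + Cqo * (1 + beta rho)
            * (\sum_(1 <= k < n.+1) q rho ^+ (n - k) * eta1 k)
          + Cqo * (1 + beta rho) * alpha rho
            * (\sum_(0 <= m < n) q rho ^+ (n - 1 - m) * eta2 m)
          + Cqo * eta2 n]).
Proof.
move=> V a1 a2 ell hell M1 M2 hM1 hM2 hA1 hA2 Cprod hCprod hprod p hp Th Vh.
move=> hmesh sreg hsreg hshape hVh hdense h0 Mlin Cqo hh0 hMlin hCqo.
move=> hstab1 hstab2 hqo1 hqo2 K1 K2 Mhat1 Mhat2 alpha beta sigma theta q.
move=> rho hrho hball hq h hh u1 u2 u1h u2h hu1 hu2 hu2E hu1E hu1h hu2h.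
move=> hu2hE hu1hE hinit hinith eta1 eta2.
have HV : seminorm_laws V by exact: H1_seminorm_laws.
have [h_gt0 _] := andP hh.
have [Vhsub _ _] := hVh h h_gt0.
have VhV x : Vh h x -> carrier V x by case: Vhsub => + _ _; exact.
have Cp0 := ltW hCprod.
have K1ge0 : 0 <= K1 by exact/fine_ge0/Lnorm_ge0.
have K2ge0 : 0 <= K2 by exact/fine_ge0/Lnorm_ge0.
have [mchi1 chi1fin _ _] := hchi1; have [mchi2 chi2fin _ _] := hchi2.
have chi1_le := ae_le_Lp_norm_oo (eball rad) chi1fin.
have chi2_le := ae_le_Lp_norm_oo (eball rad) chi2fin.
have {}mchi1 : measurable_fun (eball rad) chi1 by exact: measurable_funS mchi1.
have {}mchi2 : measurable_fun (eball rad) chi2 by exact: measurable_funS mchi2.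
have le1 := source_le hprod mchi1 chi1_le K1ge0.
have le2 := source_le hprod mchi2 chi2_le K2ge0.
have add1 := sourceD hprod mchi1 chi1_le K1ge0.
have add2 := sourceD hprod mchi2 chi2_le K2ge0.
have anti1 := source_antidual hprod mchi1 chi1_le K1ge0.
have anti2 := source_antidual hprod mchi2 chi2_le K2ge0.
pose g2 (u : sob R d) := source rad chi2 (fun x => u.1 x ^+ 2).
pose g1 (u v : sob R d) := fun xi =>
  source rad chi1 (fun x => (u.1 x)^* * v.1 x) xi + ell xi.
have g2V u : carrier V u -> carrier (antidual V) (g2 u).
  by move=> Vu; exact: anti2 (product_dominated_sqr Vu).
have g1V u v : carrier V u -> carrier V v -> carrier (antidual V) (g1 u v).
  by move=> Vu Vv; apply: antidualD => //; exact: anti1 (product_dominated_conj Vu Vv).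
have nn := nrm_ge0 HV.
have ell0 : 0 <= nrm (antidual V) ell by exact: (antidual_nrm_ge0 HV hell).
have Mhat1_0 : 0 <= Mhat1 by rewrite le_max (ltW hM1).
have Mhat2_0 : 0 <= Mhat2 by rewrite le_max (ltW hM2).
have M1le : M1 <= Mhat1 by rewrite le_max lexx.
have M2le : M2 <= Mhat2 by rewrite le_max lexx.
have L1le : Mlin <= Mhat1 by rewrite le_max lexx orbT.
have L2le : Mlin <= Mhat2 by rewrite le_max lexx orbT.
have rho0 := ltW hrho.
have alpha0 : 0 <= alpha rho by rewrite !mulr_ge0.
have beta0 : 0 <= beta rho by rewrite !mulr_ge0.
have sigma0 : 0 <= sigma rho by rewrite !mulr_ge0.
have theta0 : 0 <= theta rho by rewrite !mulr_ge0.
have g2_le u phi : carrier V u -> nrm V u <= rho -> carrier V phi ->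
    normc (g2 u phi) <= K2 * Cprod * rho * rho * nrm V phi.
  move=> Vu ur Vphi; apply: le_trans (le2 _ _ _ _ (product_dominated_sqr Vu) Vphi) _.
  by rewrite ler_wpM2r ?nn// ler_pM ?ler_wpM2l ?mulr_ge0 ?nn.
have g1_le u v phi : carrier V u -> carrier V v -> nrm V u <= rho ->
    nrm V v <= sigma rho -> carrier V phi ->
    normc (g1 u v phi) <=
    (K1 * Cprod * rho * sigma rho + nrm (antidual V) ell) * nrm V phi.
  move=> Vu Vv ur vs Vphi; apply: le_trans (le_normcD _ _) _; rewrite mulrDl lerD//.
    apply: le_trans (le1 _ _ _ _ (product_dominated_conj Vu Vv) Vphi) _.
    by rewrite ler_wpM2r ?nn// ler_pM ?ler_wpM2l ?mulr_ge0 ?nn.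
  exact: antidual_le.
(* the square is expanded as (u - v)(u + v), whence the factor 2 rho in beta *)
have g2B_le u v phi : carrier V u -> carrier V v -> nrm V u <= rho ->
    nrm V v <= rho -> carrier V phi ->
    normc (g2 u phi - g2 v phi) <= K2 * Cprod * nrm V (u - v) * (2 * rho) * nrm V phi.
  move=> Vu Vv ur vr Vphi.
  have VB := carrierB HV Vu Vv; have VD := carrierD HV Vu Vv.
  have dB := product_dominatedM VB VD.
  have dv := product_dominated_sqr Vv.
  rewrite [g2 u phi](add2 _ _ _ _ _ _ _ _ dv dB _ Vphi); last first.
    move=> x; rewrite -[(u - v).1 x]/(u.1 x - v.1 x) -[(u + v).1 x]/(u.1 x + v.1 x).
    by ring.
  rewrite addrAC subrr add0r; apply: le_trans (le2 _ _ _ _ dB Vphi) _.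
  rewrite ler_wpM2r ?nn// ler_wpM2l ?mulr_ge0 ?nn//.
  by apply: le_trans (nrmD HV Vu Vv) _; lra.
(* theta and alpha come from changing the first and the second factor of the
   product in turn *)
have g1B_le u v u' v' phi : carrier V u -> carrier V v -> carrier V u' ->
    carrier V v' -> nrm V v <= sigma rho -> nrm V u' <= rho -> carrier V phi ->
    normc (g1 u v phi - g1 u' v' phi) <=
    K1 * Cprod * (nrm V (u - u') * sigma rho + rho * nrm V (v - v')) * nrm V phi.
  move=> Vu Vv Vu' Vv' vs ur Vphi.
  have VBu := carrierB HV Vu Vu'; have VBv := carrierB HV Vv Vv'.
  have d1 := product_dominated_conj VBu Vv.
  have d2 := product_dominated_conj Vu' VBv.
  have d3 := product_dominated_conj Vu' Vv'.
  have d4 := product_dominated_conj Vu' Vv.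
  rewrite /g1 opprD addrACA subrr addr0.
  rewrite (add1 _ _ _ _ _ _ _ _ d4 d1 _ Vphi); last first.
    by move=> x; rewrite -[(u - u').1 x]/(u.1 x - u'.1 x) rmorphB/=; ring.
  rewrite (add1 _ _ _ _ _ _ _ _ d3 d2 _ Vphi); last first.
    by move=> x; rewrite -[(v - v').1 x]/(v.1 x - v'.1 x); ring.
  rewrite -[_ + _ + _]addrA addrC addKr addrC; apply: le_trans (le_normcD _ _) _.
  apply: le_trans (lerD (le1 _ _ _ _ d1 Vphi) (le1 _ _ _ _ d2 Vphi)) _.
  rewrite -mulrDl ler_wpM2r ?nn// mulrDr lerD//.
    by rewrite [leRHS]mulrA ler_wpM2l ?mulr_ge0 ?nn.
  by rewrite [leRHS]mulrA ler_wpM2r ?nn// ler_wpM2l ?mulr_ge0.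
have a2g n : forall eta, carrier V eta -> a2 (u2 n) eta = g2 (u1 n) eta := hu2E n.
have a2hg n : forall eta, Vh h eta -> a2 (u2h n) eta = g2 (u1h n) eta := hu2hE n.
have a1g n xi : carrier V xi -> a1 (u1 n.+1) xi = g1 (u1 n) (u2 n) xi.
  move=> Vxi; rewrite hu1E//; congr (_ + _).
  by apply: eq_cint => x _; rewrite mulrA.
have a1hg n xi : Vh h xi -> a1 (u1h n.+1) xi = g1 (u1h n) (u2h n) xi.
  move=> Vxi; rewrite hu1hE//; congr (_ + _).
  by apply: eq_cint => x _; rewrite mulrA.
have Vu1h n := VhV _ (hu1h n); have Vu2h n := VhV _ (hu2h n).
have stab1h := hstab1 h hh; have stab2h := hstab2 h hh.
have sigmaE : Mhat2 * (K2 * Cprod * rho * rho) = sigma rho.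
  by rewrite /sigma /beta; field.
have c2 : 0 <= K2 * Cprod * rho * rho by rewrite !mulr_ge0.
have c1 : 0 <= K1 * Cprod * rho * sigma rho + nrm (antidual V) ell.
  by rewrite addr_ge0// !mulr_ge0.
have ballE : Mhat1 * (K1 * Cprod * rho * sigma rho + nrm (antidual V) ell) <= rho.
  by apply: le_trans hball; rewrite /theta; lra.
have u2_le n : nrm V (u1 n) <= rho -> nrm V (u2 n) <= sigma rho.
  move=> u1r; rewrite -sigmaE; apply: le_trans (ler_wpM2r c2 M2le).
  apply: (continuous_solution_le HV hA2 (ltW hM2) (g2V _ (hu1 n)) c2 _ (hu2 n) (a2g n)).
  by move=> phi; exact: g2_le.
have u2h_le n : nrm V (u1h n) <= rho -> nrm V (u2h n) <= sigma rho.
  move=> u1r; rewrite -sigmaE; apply: le_trans (ler_wpM2r c2 L2le).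
  apply: (discrete_solution_le HV Vhsub stab2h (ltW hMlin)
    (antidual_restrict Vhsub (g2V _ (Vu1h n))) c2 _ (hu2h n) (a2hg n)).
  by move=> phi /VhV; exact: g2_le.
have u1_le n : nrm V (u1 n) <= rho.
  elim: n => // n IH; apply: le_trans ballE; apply: le_trans (ler_wpM2r c1 M1le).
  apply: (continuous_solution_le HV hA1 (ltW hM1) (g1V _ _ (hu1 n) (hu2 n)) c1 _
    (hu1 n.+1) (a1g n)).
  by move=> phi; apply: g1_le => //; exact: u2_le.
have u1h_le n : nrm V (u1h n) <= rho.
  elim: n => // n IH; apply: le_trans ballE; apply: le_trans (ler_wpM2r c1 L1le).
  apply: (discrete_solution_le HV Vhsub stab1h (ltW hMlin)
    (antidual_restrict Vhsub (g1V _ _ (Vu1h n) (Vu2h n))) c1 _ (hu1h n.+1) (a1hg n)).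
  by move=> phi /VhV; apply: g1_le => //; exact: u2h_le.
have err2 n : nrm V (u2 n - u2h n) <= Cqo * eta2 n + beta rho * nrm V (u1 n - u1h n).
  have VB := carrierB HV (hu1 n) (Vu1h n).
  have c0 : 0 <= K2 * Cprod * nrm V (u1 n - u1h n) * (2 * rho).
    by rewrite !mulr_ge0 ?nn.
  have -> : beta rho * nrm V (u1 n - u1h n) =
      Mhat2 * (K2 * Cprod * nrm V (u1 n - u1h n) * (2 * rho)) by rewrite /beta; ring.
  apply: le_trans (lerD (lexx _) (ler_wpM2r c0 L2le)).
  apply: (galerkin_error_le HV hA2 Vhsub stab2h (hqo2 h hh) (ltW hMlin)
    (g2V _ (hu1 n)) (g2V _ (Vu1h n)) c0 _ (hu2 n) (a2g n) (hu2h n) (a2hg n)).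
  by move=> phi /VhV; exact: g2B_le.
have err1 n : nrm V (u1 n.+1 - u1h n.+1) <= Cqo * eta1 n.+1
    + theta rho * nrm V (u1 n - u1h n) + alpha rho * nrm V (u2 n - u2h n).
  have VB1 := carrierB HV (hu1 n) (Vu1h n); have VB2 := carrierB HV (hu2 n) (Vu2h n).
  have c0 : 0 <= K1 * Cprod *
      (nrm V (u1 n - u1h n) * sigma rho + rho * nrm V (u2 n - u2h n)).
    by rewrite !mulr_ge0// addr_ge0// mulr_ge0 ?nn.
  rewrite -addrA.
  have -> : theta rho * nrm V (u1 n - u1h n) + alpha rho * nrm V (u2 n - u2h n) =
      Mhat1 * (K1 * Cprod *
        (nrm V (u1 n - u1h n) * sigma rho + rho * nrm V (u2 n - u2h n))).
    by rewrite /theta /alpha; ring.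
  apply: le_trans (lerD (lexx _) (ler_wpM2r c0 L1le)).
  apply: (galerkin_error_le HV hA1 Vhsub stab1h (hqo1 h hh) (ltW hMlin)
    (g1V _ _ (hu1 n) (hu2 n)) (g1V _ _ (Vu1h n) (Vu2h n)) c0 _ (hu1 n.+1) (a1g n)
    (hu1h n.+1) (a1hg n)).
  by move=> phi /VhV; apply: g1B_le => //; exact: u2_le.
split=> n; first by split=> //; [exact: u2_le|exact: u2h_le].
split; [exact: err2|exact: err1|].
apply: (@coupled_error_recursion R (fun n => nrm V (u1 n - u1h n))
  (fun n => nrm V (u2 n - u2h n)) eta1 eta2 _ _ _ (theta rho)) => //.
by rewrite addr_ge0// mulr_ge0.
Qed.
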